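(* Let $\Gamma$ and $\Delta$ be non-empty sets and let $1<p,q<\infty$ be such that $1/p+1/q<1$. Then the projective tensor product $\ell_p(\Gamma)\widehat{\otimes}_\pi\ell_q(\Delta)$ is subspace of a Hilbert generated space.
   Context: All Banach spaces are real; an operator is a continuous linear map. A Banach space $X$ is Hilbert generated if there exist a Hilbert space $H$ and an operator from $H$ to $X$ with dense range. ''Subspace of a Hilbert generated space'' means isomorphic to a norm closed linear subspace of some Hilbert generated Banach space. *)

(* Defs.v *)
From HB Require Import structures.
From mathcomp Require Import all_boot all_order all_algebra.
From mathcomp Require Import ring_quotient sesquilinear.
From mathcomp Require Import all_classical all_reals all_analysis.
From mathcomp Require Import ring.

Set Implicit Arguments.
Unset Strict Implicit.
Unset Printing Implicit Defensive.
Import Order.TTheory GRing.Theory Num.Theory.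
Import numFieldNormedType.Exports.

Local Open Scope classical_set_scope.
Local Open Scope ring_scope.

Record seminorm (R : realType) (E : lmodType R) := Seminorm {
  seminorm_fun :> E -> R;
  seminormD : forall x y, seminorm_fun (x + y) <= seminorm_fun x + seminorm_fun y;
  seminormZ : forall a x, seminorm_fun (a *: x) = `|a| * seminorm_fun x }.

Section SeminormTheory.
Variables (R : realType) (E : lmodType R) (s : seminorm E).

Lemma seminorm0 : s 0 = 0.
Proof. by rewrite -(scale0r 0) seminormZ normr0 mul0r. Qed.

Lemma seminormN x : s (- x) = s x.
Proof. by rewrite -scaleN1r seminormZ normrN normr1 mul1r. Qed.

Lemma seminormB x y : s (x - y) = s (y - x).
Proof. by rewrite -seminormN opprB. Qed.

Lemma seminorm_ge0 x : 0 <= s x.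
Proof.
have := seminormD s x (- x); rewrite subrr seminorm0 seminormN -mulr2n.
by rewrite pmulrn_lge0.
Qed.

Lemma seminorm_dist x y : `|s x - s y| <= s (x - y).
Proof.
rewrite ler_norml lerBlDr -{3}(subrK y x) seminormD andbT.
by rewrite lerNl opprB lerBlDr seminormB -{1}(subrK x y) seminormD.
Qed.

End SeminormTheory.

Section CauchySequences.
Variables (R : realType) (E : lmodType R) (s : seminorm E).

Definition is_cauchy : {pred nat -> E} := [pred u | `[< forall e, 0 < e ->
  \forall N \near \oo, forall m n, (N <= m)%N -> (N <= n)%N ->
    s (u m - u n) < e >]].

Lemma is_cauchy_submod_closed : submod_closed is_cauchy.
Proof.
split=> [|a u v].
  apply/asboolP => e e0; exists 0%N => // N _ m n _ _.
  by rewrite subrr seminorm0.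
move=> /asboolP uc /asboolP vc; apply/asboolP => e e0.
have a0 : 0 < `|a| + 1 by rewrite ltr_wpDl.
have /uc hu : 0 < e / 2 / (`|a| + 1) by rewrite !divr_gt0.
have /vc hv : 0 < e / 2 by rewrite divr_gt0.
near=> N => m n Nm Nn.
have -> : (a *: u + v) m - (a *: u + v) n = a *: (u m - u n) + (v m - v n).
  by rewrite /= !fctE /= scalerBr opprD addrACA.
rewrite (le_lt_trans (seminormD _ _ _))// [ltRHS]splitr seminormZ ler_ltD//.
  rewrite (@le_trans _ _ ((`|a| + 1) * s (u m - u n)))//.
    by rewrite ler_wpM2r ?seminorm_ge0// lerDl.
  rewrite mulrC -ler_pdivlMr// ltW//.
  by move: m n Nm Nn; near: N.
by move: m n Nm Nn; near: N.
Unshelve. all: by end_near. Qed.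

HB.instance Definition _ :=
  GRing.isSubmodClosed.Build R (nat -> E) is_cauchy is_cauchy_submod_closed.

Record cauchy_sequence := CauchySequence {
  cauchy_seq_val :> nat -> E;
  _ : cauchy_seq_val \in is_cauchy }.

HB.instance Definition _ := [isSub for cauchy_seq_val].
HB.instance Definition _ := [Choice of cauchy_sequence by <:].
HB.instance Definition _ := [SubChoice_isSubLmodule of cauchy_sequence by <:].

Lemma cauchy_seqP (u : cauchy_sequence) : forall e, 0 < e ->
  \forall N \near \oo, forall m n, (N <= m)%N -> (N <= n)%N ->
    s (u m - u n) < e.
Proof. by have /asboolP := valP u. Qed.

Lemma cauchy_seqD (u v : cauchy_sequence) n : (u + v) n = u n + v n.
Proof. by []. Qed.
Lemma cauchy_seqB (u v : cauchy_sequence) n : (u - v) n = u n - v n.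
Proof. by []. Qed.
Lemma cauchy_seqZ a (u : cauchy_sequence) n : (a *: u) n = a *: u n.
Proof. by []. Qed.

Lemma cvg_seminorm (u : cauchy_sequence) : cvgn (fun n => s (u n)).
Proof.
apply/cauchy_cvgP/cauchy_exP => e e0.
have [N _ hN] := cauchy_seqP u e0.
exists (s (u N)); exists N => // n /= Nn.
by rewrite /ball /= (le_lt_trans (seminorm_dist _ _ _))// (hN N)/=.
Qed.

Definition lim_seminorm (u : cauchy_sequence) : R := limn (fun n => s (u n)).

Lemma lim_seminorm0 : lim_seminorm 0 = 0.
Proof.
apply/cvg_lim => //; rewrite (_ : (fun _ => _) = cst 0); first exact: cvg_cst.
by apply/funext => n /=; exact: seminorm0.
Qed.

Lemma lim_seminormD u v :
  lim_seminorm (u + v) <= lim_seminorm u + lim_seminorm v.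
Proof.
have cu := @cvg_seminorm u; have cv := @cvg_seminorm v.
rewrite /lim_seminorm -limD//; apply: ler_lim.
- exact: cvg_seminorm.
- exact: is_cvgD.
- by apply: nearW => n; rewrite cauchy_seqD seminormD.
Qed.

Lemma lim_seminormZ a u : lim_seminorm (a *: u) = `|a| * lim_seminorm u.
Proof.
apply/cvg_lim => //.
rewrite (_ : (fun _ => _) = (fun n => `|a| * s (u n))); last first.
  by apply/funext => n; rewrite cauchy_seqZ seminormZ.
by apply: cvgMr; exact: cvg_seminorm.
Qed.

Lemma lim_seminormN u : lim_seminorm (- u) = lim_seminorm u.
Proof. by rewrite -scaleN1r lim_seminormZ normrN normr1 mul1r. Qed.

Definition is_null : {pred cauchy_sequence} := [pred u | lim_seminorm u == 0].

Lemma lim_seminorm_ge0 u : 0 <= lim_seminorm u.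
Proof.
apply: limr_ge; first exact: cvg_seminorm.
by apply: nearW => n; exact: seminorm_ge0.
Qed.

Lemma is_null_zmod_closed : zmod_closed is_null.
Proof.
split=> [|u v]; first by rewrite inE lim_seminorm0.
rewrite !inE => /eqP u0 /eqP v0; rewrite eq_le lim_seminorm_ge0 andbT.
by rewrite (le_trans (lim_seminormD _ _))// lim_seminormN u0 v0 addr0.
Qed.

HB.instance Definition _ :=
  GRing.isZmodClosed.Build cauchy_sequence is_null is_null_zmod_closed.

Local Open Scope quotient_scope.

(* The Hausdorff completion of (E, s), as Cauchy sequences modulo null ones; *)
(* completion_embed below is the canonical linear isometry of (E, s) onto a  *)
(* dense subspace.                                                           *)
Definition completion := {ideal_quot is_null}.
HB.instance Definition _ := GRing.Zmodule.on completion.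
HB.instance Definition _ := ZmodQuotient.on completion.

Definition to_completion (u : cauchy_sequence) : completion := \pi u.

Lemma to_completion_eq u v :
  (to_completion u = to_completion v) <-> lim_seminorm (u - v) = 0.
Proof.
split=> [/eqP|/eqP h]; first by rewrite -Quotient.idealrBE inE => /eqP.
by apply/eqP; rewrite -Quotient.idealrBE inE.
Qed.

Lemma to_completionD u v :
  to_completion (u + v) = to_completion u + to_completion v.
Proof. by rewrite /to_completion !piE. Qed.

Lemma to_completionN u : to_completion (- u) = - to_completion u.
Proof. by rewrite /to_completion !piE. Qed.

Lemma to_completionB u v :
  to_completion (u - v) = to_completion u - to_completion v.
Proof. by rewrite to_completionD to_completionN. Qed.

Lemma to_completion_repr (x : completion) : to_completion (repr x) = x.
Proof. exact: reprK. Qed.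

Definition completion_scale a (x : completion) : completion :=
  to_completion (a *: repr x).

Lemma to_completionZ a u :
  to_completion (a *: u) = completion_scale a (to_completion u).
Proof.
apply/to_completion_eq; rewrite -scalerBr lim_seminormZ.
suff -> : lim_seminorm (u - repr (to_completion u)) = 0 by rewrite mulr0.
by apply/to_completion_eq; rewrite to_completion_repr.
Qed.

Fact completion_scaleA a b x :
  completion_scale a (completion_scale b x) = completion_scale (a * b) x.
Proof. by rewrite -to_completionZ scalerA. Qed.

Fact completion_scale1 : left_id 1 completion_scale.
Proof. by move=> x; rewrite /completion_scale scale1r to_completion_repr. Qed.

Fact completion_scaleDr : right_distributive completion_scale +%R.
Proof.
move=> a x y; rewrite -{1}[x]to_completion_repr -{1}[y]to_completion_repr.
by rewrite -to_completionD -to_completionZ scalerDr to_completionD.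
Qed.

Fact completion_scaleDl x : {morph completion_scale^~ x : a b / a + b}.
Proof. by move=> a b; rewrite /completion_scale scalerDl to_completionD. Qed.

HB.instance Definition _ := GRing.Zmodule_isLmodule.Build R completion
  completion_scaleA completion_scale1 completion_scaleDr completion_scaleDl.

Definition completion_norm (x : completion) : R := lim_seminorm (repr x).

Lemma completion_normE u : completion_norm (to_completion u) = lim_seminorm u.
Proof.
have h : lim_seminorm (repr (to_completion u) - u) = 0.
  by apply/to_completion_eq; rewrite to_completion_repr.
apply/eqP; rewrite eq_le /completion_norm; apply/andP; split.
  by rewrite -{1}(subrK u (repr _)) (le_trans (lim_seminormD _ _))// h add0r.
rewrite -{1}(subKr (repr (to_completion u)) u).
by rewrite (le_trans (lim_seminormD _ _))// lim_seminormN h addr0.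
Qed.

Fact completion_normD x y :
  completion_norm (x + y) <= completion_norm x + completion_norm y.
Proof.
rewrite -{1}[x]to_completion_repr -{1}[y]to_completion_repr.
by rewrite -to_completionD completion_normE lim_seminormD.
Qed.

Fact completion_normZ a x : completion_norm (a *: x) = `|a| * completion_norm x.
Proof. by rewrite completion_normE lim_seminormZ. Qed.

Fact completion_norm0_eq0 x : completion_norm x = 0 -> x = 0.
Proof.
move=> x0; rewrite -[x]to_completion_repr -(subrr (to_completion 0)).
rewrite -to_completionB subrr.
by apply/to_completion_eq; rewrite subr0.
Qed.

HB.instance Definition _ := Lmodule_isNormed.Build R completion
  completion_normD completion_normZ completion_norm0_eq0.

Lemma norm_to_completion u : `|to_completion u| = lim_seminorm u.
Proof. exact: completion_normE. Qed.

Fact const_is_cauchy (x : E) : (fun _ : nat => x) \in is_cauchy.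
Proof.
apply/asboolP => e e0; exists 0%N => // N _ m n _ _.
by rewrite subrr seminorm0.
Qed.

Definition completion_embed (x : E) : completion :=
  to_completion (CauchySequence (const_is_cauchy x)).

Lemma norm_completion_embed x : `|completion_embed x| = s x.
Proof. by rewrite norm_to_completion; apply: cvg_lim => //=; exact: cvg_cst. Qed.

Fact completion_embed_is_linear : linear completion_embed.
Proof.
move=> a x y; rewrite /completion_embed; have -> : forall u,
  a *: to_completion u = to_completion (a *: u) by move=> u; rewrite to_completionZ.
by rewrite -to_completionD; congr to_completion; exact/val_inj.
Qed.
HB.instance Definition _ := GRing.isLinear.Build R E completion _
  completion_embed completion_embed_is_linear.

Lemma completion_embed_cvg (u : cauchy_sequence) :
  completion_embed (u n) @[n --> \oo] --> to_completion u.
Proof.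
apply/cvgrPdist_le => e e0; have [N _ hN] := cauchy_seqP u e0.
exists N => // n /= Nn.
rewrite -to_completionB norm_to_completion.
apply: limr_le; first exact: cvg_seminorm.
exists n => // m /= nm.
by apply/ltW/(hN N) => //=; exact: leq_trans nm.
Qed.

Lemma completion_embed_dense : dense (range completion_embed).
Proof.
move=> O [x Ox] oO.
have /(_ O) := @completion_embed_cvg (repr x).
rewrite to_completion_repr => /(_ (open_nbhs_nbhs (conj oO Ox))) [N _ /(_ N)].
by move=> /(_ (leqnn _)) /= hO; exists (completion_embed (repr x N)); split.
Qed.

Fact completion_complete (F : set_system completion) :
  ProperFilter F -> cauchy F -> cvg F.
Proof.
move=> FF /cauchyP Fc.
have h n : exists y : E, F (ball (completion_embed y) n.+1%:R^-1).
  have [|x Fx] := Fc (n.+1%:R^-1 / 2); first by rewrite divr_gt0.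
  have b0 : ball x (n.+1%:R^-1 / 2) !=set0.
    by exists x; apply: ballxx; rewrite divr_gt0.
  have [w [xy [y _ yE]]] := completion_embed_dense b0 (@ball_open _ _ _ _).
  exists y; apply: filterS Fx => z xz; rewrite yE.
  exact: (ball_splitr xy).
have {h} [y hy] := choice h.
have yd m n : s (y m - y n) < m.+1%:R^-1 + n.+1%:R^-1.
  rewrite -norm_completion_embed raddfB/=.
  have [z [ym yn]] := filter_ex (filterI (hy m) (hy n)).
rewrite -(subrKA z) (le_lt_trans (ler_normD _ _))// ltrD//.
  by rewrite distrC.
have cy : y \in is_cauchy.
  apply/asboolP => e e0; near=> N => m n Nm Nn.
  apply: lt_trans (yd m n) _; rewrite (splitr e).
  have he : N.+1%:R^-1 < e / 2.
    by near: N; apply: (near_infty_natSinv_lt (PosNum (divr_gt0 e0 (ltr0n R 2)))).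
  by apply: ltrD; apply: le_lt_trans he;
    rewrite lef_pV2 ?posrE ?ltr0Sn// ler_nat ltnS.
pose u := CauchySequence cy.
apply/cvg_ex; exists (to_completion u); apply/cvg_ballP => e e0.
have /cvgrPdist_lt/(_ (e / 2)) := @completion_embed_cvg u.
rewrite divr_gt0// => /(_ isT) hu.
near \oo => n.
have he : n.+1%:R^-1 < e / 2.
  by near: n; apply: (near_infty_natSinv_lt (PosNum (divr_gt0 e0 (ltr0n R 2)))).
have hn : ball (to_completion u) (e / 2) (completion_embed (y n)).
  by rewrite -ball_normE/=; near: n.
apply: filterS (hy n) => z hz; rewrite (splitr e).
apply: ball_triangle hn _; exact: le_ball (ltW he) _ hz.
Unshelve. all: by end_near. Qed.

HB.instance Definition _ := Uniform_isComplete.Build completion completion_complete.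

End CauchySequences.
Section Ell.
Variables (R : realType) (I : choiceType) (p : R).

Definition ell_sum (f : I -> R) : \bar R :=
  (\esum_(i in [set: I]) (`|f i| `^ p)%:E)%E.

Definition is_ell : {pred I -> R^o} := [pred f | (ell_sum f < +oo)%E].

Hypothesis p1 : 1 <= p.

Let p0 : 0 < p. Proof. exact: lt_le_trans p1. Qed.

Lemma ell_sum_ge0 f : (0 <= ell_sum f)%E.
Proof. by apply: esum_ge0 => i _; rewrite lee_fin powR_ge0. Qed.

Lemma esum_pZl (c : R) (a : I -> \bar R) : 0 <= c -> (forall i, 0 <= a i)%E ->
  (\esum_(i in [set: I]) (c%:E * a i) = c%:E * \esum_(i in [set: I]) a i)%E.
Proof.
move=> c0 a0; rewrite /esum -ereal_supZl//; last first.
  by apply/set0P; exists (\sum_(x \in set0) a x)%E; exists set0 => //; split.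
congr ereal_sup; apply/seteqP; split=> [_ [A hA <-]|_ [_ [A hA <-] <-]] /=.
  by exists (\sum_(x \in A) a x)%E; [exists A|rewrite ge0_mule_fsumr].
by exists A => //; rewrite ge0_mule_fsumr.
Qed.

Lemma ell_sumZ a f : ell_sum (fun i => a * f i) = ((`|a| `^ p)%:E * ell_sum f)%E.
Proof.
rewrite -esum_pZl ?powR_ge0//.
by apply: eq_esum => i _; rewrite normrM powRM.
Qed.

Lemma powR_convex_bound (s t a b : R) : 0 < s -> 0 < t ->
  `|a + b| `^ p <= (s + t) `^ p * (s / (s + t) * (`|a| / s) `^ p +
                                   t / (s + t) * (`|b| / t) `^ p).
Proof.
move=> s0 t0; have st0 : 0 < s + t by exact: addr_gt0.
have w01 : 0 <= s / (s + t) <= 1.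
  by rewrite divr_ge0 ?(ltW s0) ?(ltW st0)//= ler_pdivrMr// mul1r lerDl ltW.
case/andP: w01 => w0 w1; pose w := Itv01 w0 w1.
have w' : 1 - s / (s + t) = t / (s + t).
  by apply: (mulIf (lt0r_neq0 st0)); rewrite mulrBl !divfK ?gt_eqF// mul1r addrAC subrr add0r.
have h : (s / (s + t) * (`|a| / s) + t / (s + t) * (`|b| / t)) `^ p <=
    s / (s + t) * (`|a| / s) `^ p + t / (s + t) * (`|b| / t) `^ p.
  rewrite -w'; apply: (@convex_powR R p p1 w (`|a| / s) (`|b| / t));
    by rewrite inE/= in_itv/= andbT divr_ge0 ?(ltW s0) ?(ltW t0).
apply: le_trans (ler_wpM2l (powR_ge0 _ _) h).
rewrite -powRM ?(ltW st0)//; last first.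
  by rewrite addr_ge0// !mulr_ge0// ?invr_ge0 ?(ltW s0) ?(ltW t0) ?(ltW st0).
apply: ge0_ler_powR; rewrite ?nnegrE ?(ltW p0)//.
  by rewrite mulr_ge0 ?(ltW st0)// addr_ge0// !mulr_ge0// ?invr_ge0 ?(ltW s0) ?(ltW t0) ?(ltW st0).
rewrite [leRHS](_ : _ = `|a| + `|b|) ?ler_normD//.
by field; rewrite !gt_eqF.
Qed.

Lemma ell_sumD (s t : R) (f g : I -> R) : 0 < s -> 0 < t ->
  (ell_sum (fun i => (f i + g i)%R) <=
   ((s + t) `^ p)%:E * ((s / (s + t) * s^-1 `^ p)%:E * ell_sum f +
                        (t / (s + t) * t^-1 `^ p)%:E * ell_sum g))%E.
Proof.
move=> s0 t0; have st0 : 0 < s + t by exact: addr_gt0.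
have c1 : 0 <= s / (s + t) * s^-1 `^ p by rewrite mulr_ge0 ?powR_ge0 ?divr_ge0 ?ltW.
have c2 : 0 <= t / (s + t) * t^-1 `^ p by rewrite mulr_ge0 ?powR_ge0 ?divr_ge0 ?ltW.
have fp h i : (0 <= (`|h i : R| `^ p)%:E)%E by rewrite lee_fin powR_ge0.
rewrite -!esum_pZl// -esumD; last 2 first.
- by move=> i _; rewrite mule_ge0.
- by move=> i _; rewrite mule_ge0.
rewrite -esum_pZl ?powR_ge0//; last by move=> i; rewrite adde_ge0// mule_ge0.
apply: le_esum => i _; rewrite -!EFinM lee_fin.
apply: le_trans (powR_convex_bound _ _ s0 t0) _.
rewrite ler_wpM2l ?powR_ge0// !powRM ?invr_ge0 ?(ltW s0) ?(ltW t0)//.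
by rewrite !(mulrC (`|_| `^ p)) !mulrA.
Qed.

Lemma is_ell_submod_closed : submod_closed is_ell.
Proof.
split=> [|a f g].
  rewrite inE /ell_sum esum1 ?ltry// => i _ /=.
  by rewrite /= normr0 powR0// gt_eqF.
rewrite !inE => fp gp.
apply: le_lt_trans (ell_sumD (fun i => a * f i) g ltr01 ltr01) _.
rewrite lte_mul_pinfty ?lee_fin ?powR_ge0// ell_sumZ lte_add_pinfty//.
  rewrite lte_mul_pinfty ?lee_fin ?mulr_ge0 ?powR_ge0 ?invr_ge0 ?addr_ge0//.
  by rewrite lte_mul_pinfty ?lee_fin ?powR_ge0.
by rewrite lte_mul_pinfty ?lee_fin ?mulr_ge0 ?powR_ge0 ?invr_ge0 ?addr_ge0.
Qed.

HB.instance Definition _ :=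
  GRing.isSubmodClosed.Build R (I -> R^o) is_ell is_ell_submod_closed.

(* l_p(I) for an arbitrary index set I. The proof of 1 <= p is a phantom     *)
(* argument, needed only to infer the norm.                                  *)
Record ell (ge1_p : 1 <= p) := Ell { ell_val :> I -> R^o; _ : ell_val \in is_ell }.

HB.instance Definition _ := [isSub for @ell_val p1].
HB.instance Definition _ := [Choice of ell p1 by <:].
HB.instance Definition _ := [SubChoice_isSubLmodule of ell p1 by <:].

Definition ell_norm (f : ell p1) : R := fine (ell_sum f) `^ p^-1.

Lemma ell_sumE (f : ell p1) : ell_sum f = (ell_norm f `^ p)%:E.
Proof.
rewrite /ell_norm -powRrM mulVf ?gt_eqF// powRr1 ?fine_ge0 ?ell_sum_ge0//.
rewrite fineK// ge0_fin_numE ?ell_sum_ge0//.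
by have := valP f; rewrite inE.
Qed.

Lemma ell_norm_ge0 (f : ell p1) : 0 <= ell_norm f.
Proof. exact: powR_ge0. Qed.

Fact ell_norm0_eq0 (f : ell p1) : ell_norm f = 0 -> f = 0.
Proof.
move=> f0; apply/val_inj/funext => i /=; apply/eqP; rewrite -normr_eq0.
have : ((`|f i| `^ p)%:E <= ell_sum f)%E.
  rewrite -(@esum_set1 R I i (fun i => (`|f i| `^ p)%:E)%E) ?lee_fin ?powR_ge0//.
  rewrite /ell_sum [leRHS](esumID [set i])//.
  by rewrite setTI leeDl// esum_ge0// => j _; rewrite lee_fin powR_ge0.
rewrite ell_sumE f0 powR0 ?(gt_eqF p0)// lee_fin => h.
have /eqP : `|f i| `^ p = 0 by apply/eqP; rewrite eq_le h powR_ge0.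
by rewrite powR_eq0 => /andP[].
Qed.

Fact ell_normZ a (f : ell p1) : ell_norm (a *: f) = `|a| * ell_norm f.
Proof.
rewrite /ell_norm (_ : ell_sum (a *: f) = (`|a| `^ p)%:E * ell_sum f)%E; last first.
  exact: ell_sumZ.
rewrite fineM//; last by rewrite ell_sumE.
rewrite powRM ?powR_ge0 ?fine_ge0 ?ell_sum_ge0//= -powRrM mulfV ?gt_eqF//.
by rewrite powRr1.
Qed.

Fact ell_normD (f g : ell p1) : ell_norm (f + g) <= ell_norm f + ell_norm g.
Proof.
have [f0|f0] := eqVneq (ell_norm f) 0.
  by rewrite (ell_norm0_eq0 f0) add0r lerDr ell_norm_ge0.
have [g0|g0] := eqVneq (ell_norm g) 0.
  by rewrite (ell_norm0_eq0 g0) addr0 lerDl ell_norm_ge0.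
have {}f0 : 0 < ell_norm f by rewrite lt0r f0 ell_norm_ge0.
have {}g0 : 0 < ell_norm g by rewrite lt0r g0 ell_norm_ge0.
have := ell_sumD f g f0 g0.
rewrite -[ell_sum (fun i => _)]/(ell_sum (f + g)) !ell_sumE.
move: (ell_norm_ge0 (f + g)) f0 g0.
move: (ell_norm (f + g)) (ell_norm f) (ell_norm g) => n s t n0 s0 t0.
have st0 : 0 < s + t by exact: addr_gt0.
rewrite -!EFinM lee_fin -!mulrA -!powRM ?invr_ge0 ?(ltW s0) ?(ltW t0)//.
rewrite !mulVf ?gt_eqF// powR1 !mulr1 -mulrDl mulfV ?gt_eqF// mulr1 => h.
rewrite leNgt; apply/negP => /(@gt0_ltr_powR _ p p0).
by rewrite !nnegrE n0 (ltW st0) => /(_ isT isT); rewrite ltNge h.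
Qed.

HB.instance Definition _ :=
  Lmodule_isNormed.Build R (ell p1) ell_normD ell_normZ ell_norm0_eq0.

End Ell.

Section TensorProduct.
Variables (R : realType) (X Y : lmodType R).

(* The tensor x (x) y is the evaluation functional B |-> B x y on the space of *)
(* all bilinear forms on X * Y; rank_one_sum r is the sum of the tensors       *)
(* z.1 (x) z.2 over the pairs z listed in r. The algebraic tensor product is   *)
(* the span of these functionals: bilinear forms separate the tensors, so that *)
(* rank_one_sum r = rank_one_sum t iff r and t represent the same tensor.      *)
Definition rank_one_sum (r : seq (X * Y)) : {bilinear X -> Y -> R^o} -> R^o :=
  fun B => \sum_(z <- r) B z.1 z.2.

Definition is_tensor : {pred {bilinear X -> Y -> R^o} -> R^o} :=
  [pred u | `[< exists r, u = rank_one_sum r >]].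

Lemma rank_one_sum_cat r t :
  rank_one_sum (r ++ t) = rank_one_sum r + rank_one_sum t.
Proof. by apply/funext => B; rewrite /rank_one_sum big_cat. Qed.

Lemma rank_one_sumZ a r :
  rank_one_sum [seq (a *: z.1, z.2) | z <- r] = a *: rank_one_sum r.
Proof.
apply/funext => B; rewrite /rank_one_sum big_map [RHS]scaler_sumr.
by apply: eq_bigr => z _; rewrite /= linearZl_LR.
Qed.

Lemma is_tensor_submod_closed : submod_closed is_tensor.
Proof.
split=> [|a _ _ /asboolP[r ->] /asboolP[t ->]]; apply/asboolP.
  by exists [::]; apply/funext => B; rewrite /rank_one_sum big_nil.
by exists ([seq (a *: z.1, z.2) | z <- r] ++ t);
  rewrite rank_one_sum_cat rank_one_sumZ.
Qed.

HB.instance Definition _ := GRing.isSubmodClosed.Build R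
  ({bilinear X -> Y -> R^o} -> R^o) is_tensor is_tensor_submod_closed.

Record tensor := Tensor {
  tensor_val :> {bilinear X -> Y -> R^o} -> R^o;
  _ : tensor_val \in is_tensor }.

HB.instance Definition _ := [isSub for tensor_val].
HB.instance Definition _ := [Choice of tensor by <:].
HB.instance Definition _ := [SubChoice_isSubLmodule of tensor by <:].

End TensorProduct.

Section ProjectiveTensorProduct.
Variables (R : realType) (X Y : normedModType R).
Implicit Types (r : seq (X * Y)) (u v : tensor X Y).

Definition representation_cost r : R := \sum_(z <- r) `|z.1| * `|z.2|.

(* inf of sum |x_i| |y_i| over all finite representations u = sum x_i (x) y_i *)
Definition projective_norm u : R :=
  inf [set representation_cost r | r in [set r | tensor_val u = rank_one_sum r]].

Lemma representation_cost_ge0 r : 0 <= representation_cost r.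
Proof. by apply: sumr_ge0 => z _; rewrite mulr_ge0. Qed.

Lemma projective_norm_has_inf u : has_inf
  [set representation_cost r | r in [set r | tensor_val u = rank_one_sum r]].
Proof.
split; last by exists 0 => _ [r _ <-]; exact: representation_cost_ge0.
by have /asboolP[r ur] := valP u; exists (representation_cost r), r.
Qed.

Lemma projective_norm_le u r :
  tensor_val u = rank_one_sum r -> projective_norm u <= representation_cost r.
Proof.
by move=> ur; apply: ge_inf; [case: (projective_norm_has_inf u)|exists r].
Qed.

Lemma projective_norm_adherent u (e : R) : 0 < e -> exists2 r,
  tensor_val u = rank_one_sum r & representation_cost r < projective_norm u + e.
Proof.
move=> e0; have [_ [r ur <-] h] := inf_adherent e0 (projective_norm_has_inf u).
by exists r.
Qed.

Fact projective_normD u v :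
  projective_norm (u + v) <= projective_norm u + projective_norm v.
Proof.
apply/ler_addgt0Pr => e e0; have e20 : 0 < e / 2 by rewrite divr_gt0.
have [r ur hr] := projective_norm_adherent u e20.
have [t vt ht] := projective_norm_adherent v e20.
have uvE : tensor_val (u + v) = rank_one_sum (r ++ t).
  by rewrite rank_one_sum_cat -ur -vt.
rewrite (le_trans (projective_norm_le uvE))//.
rewrite /representation_cost big_cat/= (splitr e) addrACA.
by rewrite lerD// ltW.
Qed.

Lemma projective_normZ_le a u :
  projective_norm (a *: u) <= `|a| * projective_norm u.
Proof.
have h r : tensor_val u = rank_one_sum r ->
    projective_norm (a *: u) <= `|a| * representation_cost r.
  move=> ur; have auE : tensor_val (a *: u) =
      rank_one_sum [seq (a *: z.1, z.2) | z <- r] by rewrite rank_one_sumZ -ur.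
  rewrite (le_trans (projective_norm_le auE))//.
  rewrite /representation_cost big_map mulr_sumr le_eqVlt; apply/orP; left.
  by apply/eqP/eq_bigr => z _ /=; rewrite normrZ mulrA.
apply/ler_addgt0Pr => e e0.
have a0 : 0 < `|a| + 1 by rewrite ltr_wpDl.
have [r ur hr] := projective_norm_adherent u (divr_gt0 e0 a0).
rewrite (le_trans (h _ ur))// (le_trans (ler_wpM2l (normr_ge0 a) (ltW hr)))//.
rewrite mulrDr lerD2l mulrCA ler_piMr ?(ltW e0)//.
by rewrite ler_pdivrMr// mul1r lerDl.
Qed.

Fact projective_normZ a u : projective_norm (a *: u) = `|a| * projective_norm u.
Proof.
apply/eqP; rewrite eq_le projective_normZ_le/=.
have [->|a0] := eqVneq a 0.
  rewrite normr0 mul0r; apply: lb_le_inf => [|_ [r _ <-]].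
    exact: (projective_norm_has_inf _).1.
  exact: representation_cost_ge0.
rewrite -ler_pdivlMl ?normr_gt0// -normfV.
by have := projective_normZ_le a^-1 (a *: u); rewrite scalerA mulVf// scale1r.
Qed.

Definition projective_seminorm : seminorm (tensor X Y) :=
  Seminorm projective_normD projective_normZ.

Definition projective_tensor_product : completeNormedModType R :=
  completion projective_seminorm.

End ProjectiveTensorProduct.

Section HilbertGenerated.
Variable R : realType.
Implicit Types X Y H : completeNormedModType R.

Definition is_hilbert H :=
  exists ip : {dot H for idfun}, forall x : H, `|x| ^+ 2 = ip x x.

Definition hilbert_generated X := exists H, is_hilbert H /\
  exists T : {linear H -> X}, continuous T /\ dense (range T).

(* J is a linear homeomorphism of X onto the closed subspace range J of Y. *)
Definition subspace_of_hilbert_generated X := exists Y, hilbert_generated Y /\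
  exists J : {linear X -> Y}, [/\ continuous J, closed (range J) &
    exists K : Y -> X, cancel J K /\ {within range J, continuous K}].

End HilbertGenerated.

(* Main.v *)
(* Write X for the projective tensor product and t(g, d) for the elementary    *)
(* tensors of unit vectors; they span a dense subspace of X. An element phi   *)
(* of the dual ball of X is a bilinear form of norm at most 1, with matrix    *)
(* entries phi(t(g, d)). If n of these entries in pairwise distinct rows and  *)
(* columns are at least eps in modulus, then a suitable choice of signs gives *)
(* eps n <= n^(1/p + 1/q), which bounds n because 1/p + 1/q < 1; a single row *)
(* or column is treated in the same way. Hence the number of entries of       *)
(* modulus at least eps is bounded uniformly in phi.                          *)
(* Truncating the entries below 1/(n+1) for every n and weighting the levels  *)
(* yields vectors w(phi) in the unit ball of H = l_2(N x Gamma x Delta) such  *)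
(* that each function phi |-> phi(x) on the dual ball is a uniform limit of   *)
(* functions phi |-> <a, w(phi)> with a in H. In the space of bounded         *)
(* functions on the dual ball, X (embedded isometrically, by Hahn-Banach)     *)
(* then lies in the closure of the image of H.                                *)
From HB Require Import structures.
From mathcomp Require Import all_boot all_order all_algebra.
From mathcomp Require Import sesquilinear.
From mathcomp Require Import all_classical all_reals all_analysis.
From mathcomp Require Import ring lra.
Require Import Defs.

Set Implicit Arguments.
Unset Strict Implicit.
Unset Printing Implicit Defensive.
Import Order.TTheory GRing.Theory Num.Theory.
Import numFieldNormedType.Exports.

Local Open Scope classical_set_scope.
Local Open Scope ring_scope.

(** * The Hahn-Banach theorem *)

(** The argument separates a criterion valid in every Banach space from a count special to bilinear
    forms. Criterion, [subspace_of_hilbert_generated_count]: let [e] be a total family in the unit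
    ball such that, for each [d > 0], the number of indices with [|phi (e i)| >= d] is bounded
    uniformly over the dual ball. Cutting phi at the heights [1/(n+1)] and damping level n by a
    weight [c n] sends the dual ball to bounded vectors [w phi] of a Hilbert space, and evaluation
    at each x is a uniform limit of pairings with them. [subspace_of_hilbert_generated_pairing] then
    amalgamates X and the Hilbert space into one Banach space, in which X sits isometrically by
    Hahn-Banach and, thanks to the approximation, the Hilbert space has dense image. Count,
    [contractive_bilinear_count]: sign vectors on n coordinates have norms at most [n^(1/p)] and
    [n^(1/q)], too small to allow many large entries along a row, a column or a matching;
    [ex_matching] reduces any set of entries to these three shapes. [total_pure_tensor] supplies the
    total family. *)

Section HahnBanach.
Variables (R : realType) (E : lmodType R).
Implicit Types (s q : E -> R) (x y : E).

Definition sublinear s := (forall x y, s (x + y) <= s x + s y) /\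
  (forall a x, 0 <= a -> s (a *: x) <= a * s x).

Lemma sublinear0 s : sublinear s -> s 0 = 0.
Proof.
move=> [sD sZ]; apply/eqP; rewrite eq_le; apply/andP; split.
  by have := sZ 0 0 (lexx _); rewrite scale0r mul0r.
by have := sD 0 0; rewrite addr0 -[leLHS]addr0 lerD2l.
Qed.

Lemma sublinear_geN s x : sublinear s -> - s (- x) <= s x.
Proof.
move=> ss; have := ss.1 x (- x).
by rewrite subrr sublinear0// -lerBlDr sub0r.
Qed.

Lemma sublinearZ s a x : sublinear s -> 0 <= a -> s (a *: x) = a * s x.
Proof.
move=> ss; rewrite le_eqVlt => /predU1P[<-|a0].
  by rewrite scale0r mul0r sublinear0.
apply/eqP; rewrite eq_le ss.2 ?(ltW a0)//= -ler_pdivlMl//.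
rewrite -{1}[x](scale1r x) -(mulVf (lt0r_neq0 a0)) -scalerA.
by rewrite ss.2// invr_ge0 ltW.
Qed.

(* The largest sublinear functional below s that is at most - s y at - y. *)
Definition sublinear_shift s y x : R :=
  inf [set s (x + t *: y) - t * s y | t in [set t | 0 <= t]].

Section Shift.
Variables (s : E -> R) (y : E).
Hypothesis ss : sublinear s.

Let shift_has_inf x :
  has_inf [set s (x + t *: y) - t * s y | t in [set t | 0 <= t]].
Proof.
split; first by exists (s (x + 0 *: y) - 0 * s y), 0 => /=.
exists (- s (- x)) => _ [t /= t0 <-].
have := ss.1 (- x) (x + t *: y); rewrite addKr sublinearZ//; lra.
Qed.

Lemma sublinear_shift_le t x : 0 <= t ->
  sublinear_shift s y x <= s (x + t *: y) - t * s y.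
Proof.
by move=> t0; apply: ge_inf; [case: (shift_has_inf x)|exists t].
Qed.

Lemma sublinear_shift_adherent x e : 0 < e -> exists t, 0 <= t /\
  s (x + t *: y) - t * s y < sublinear_shift s y x + e.
Proof.
move=> e0; have [_ [t /= t0 <-] h] := inf_adherent e0 (shift_has_inf x).
by exists t.
Qed.

Lemma sublinear_shift_sublinear : sublinear (sublinear_shift s y).
Proof.
split=> [x z|a x].
  apply/ler_addgt0Pr => e e0; have e20 : 0 < e / 2 by rewrite divr_gt0.
  have [t [t0 ht]] := sublinear_shift_adherent x e20.
  have [u [u0 hu]] := sublinear_shift_adherent z e20.
  have := sublinear_shift_le (x + z) (addr_ge0 t0 u0).
  rewrite scalerDl addrACA mulrDl => h; have := ss.1 (x + t *: y) (z + u *: y).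
  by lra.
rewrite le_eqVlt => /predU1P[<-|a0].
  have := sublinear_shift_le (0 *: x) (lexx (0 : R)).
  by rewrite !scale0r addr0 !mul0r subr0 (sublinear0 ss).
rewrite -ler_pdivrMl//; apply/ler_addgt0Pr => e e0.
have [t [t0 ht]] := sublinear_shift_adherent x e0.
rewrite ler_pdivrMl//; apply: le_trans (ler_wpM2l (ltW a0) (ltW ht)).
have := sublinear_shift_le (a *: x) (mulr_ge0 (ltW a0) t0).
by rewrite -scalerA -scalerDr (sublinearZ _ ss) ?(ltW a0)// mulrBr mulrA.
Qed.

Lemma sublinear_shift_le_self x : sublinear_shift s y x <= s x.
Proof.
by have := sublinear_shift_le x (lexx 0); rewrite scale0r addr0 mul0r subr0.
Qed.

Lemma sublinear_shiftN : sublinear_shift s y (- y) <= - s y.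
Proof.
have := sublinear_shift_le (- y) ler01.
by rewrite scale1r addNr sublinear0// mul1r add0r.
Qed.

End Shift.

(** Zorn for the reversed pointwise order. The infimum of a chain is finite because every member is
    at least [- s (- x)] at x, and it is subadditive because two members chosen for x and for y can
    both be replaced by the smaller one. *)
Lemma ex_minimal_sublinear s : sublinear s -> exists q, [/\ sublinear q,
  forall x, q x <= s x &
  forall q', sublinear q' -> (forall x, q' x <= q x) -> q' = q].
Proof.
move=> ss; pose T := {q : E -> R | sublinear q /\ forall x, q x <= s x}.
pose below (q q' : T) := `[< forall x, sval q' x <= sval q x >].
have [||||[q [sq qs]] qmin] := @Zorn T below.
- by move=> q; apply/asboolP.
- move=> q q' q'' /asboolP h /asboolP h'; apply/asboolP => x.
  exact: le_trans (h' x) (h x).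
- move=> [q hq] [q' hq'] /asboolP/= h /asboolP/= h'.
  apply/eq_exist/funext => x.
  by apply/eqP; rewrite eq_le h h'.
- move=> A Atot; have [->|/set0P[q0 Aq0]] := eqVneq A set0.
    by exists (exist _ s (conj ss (fun x => lexx (s x)))).
  pose m x := inf [set sval q x | q in A].
  have minf (x : E) : has_inf [set sval q x | q in A].
    split; first by exists (sval q0 x), q0.
    exists (- s (- x)) => _ [[q [sq qs]] _ <-] /=.
    by apply: le_trans (sublinear_geN x sq); rewrite lerN2 qs.
  have m_le (q : T) x : A q -> m x <= sval q x.
    by move=> Aq; apply: ge_inf; [case: (minf x)|exists q].
  have m_adh x e : 0 < e -> exists2 q : T, A q & sval q x < m x + e.
    by move=> e0; have [_ [q Aq <-] ?] := inf_adherent e0 (minf x); exists q.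
  have sm : sublinear m.
    split=> [x y|a x a0].
      apply/ler_addgt0Pr => e e0; have e20 : 0 < e / 2 by rewrite divr_gt0.
      have [q Aq hq] := m_adh x _ e20; have [q' Aq' hq'] := m_adh y _ e20.
      have [r [Ar rx ry]] : exists r : T, [/\ A r, sval r x <= sval q x
          & sval r y <= sval q' y].
        by have [/asboolP h|/asboolP h] := Atot _ _ Aq Aq';
          [exists q'|exists q].
      have := (svalP r).1.1 x y; have := m_le r (x + y) Ar; lra.
    apply/ler_addgt0Pr => e e0; have a10 : 0 < a + 1 by rewrite ltr_wpDl.
    have [q Aq hq] := m_adh x _ (divr_gt0 e0 a10).
    rewrite (le_trans (m_le q _ Aq))// (sublinearZ _ (svalP q).1)//.
    rewrite (le_trans (ler_wpM2l a0 (ltW hq)))// mulrDr lerD2l mulrCA.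
    by rewrite ler_piMr ?(ltW e0)// ler_pdivrMr// mul1r lerDl.
  have ms x : m x <= s x.
    by apply: le_trans (m_le q0 x Aq0) _; have [] := svalP q0.
  exists (exist _ m (conj sm ms)) => q Aq; apply/asboolP => x /=.
  exact: m_le.
exists q; split=> // q' sq' qq'.
have q's x : q' x <= s x by apply: le_trans (qs x).
suff /qmin/(congr1 sval)/= : below (exist _ q (conj sq qs))
  (exist _ q' (conj sq' q's)) by [].
exact/asboolP.
Qed.

(** By minimality q equals its own shift in direction x, and that shift is at most [- q x] at
    [- x]. *)
Lemma minimal_sublinearN q : sublinear q ->
  (forall q', sublinear q' -> (forall x, q' x <= q x) -> q' = q) ->
  forall x, q (- x) = - q x.
Proof.
move=> sq qmin x; apply/eqP; rewrite eq_le; apply/andP; split.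
  rewrite -{1}(qmin _ (sublinear_shift_sublinear x sq)).
    exact: sublinear_shiftN.
  exact: sublinear_shift_le_self.
by rewrite lerNl; exact: sublinear_geN.
Qed.

Lemma minimal_sublinear_linear q : sublinear q ->
  (forall q', sublinear q' -> (forall x, q' x <= q x) -> q' = q) ->
  linear_for *%R q.
Proof.
move=> sq qmin; have qN := minimal_sublinearN sq qmin.
have qD x y : q (x + y) = q x + q y.
  apply/eqP; rewrite eq_le sq.1 andTb.
  have := sq.1 (x + y) (- y); rewrite addrK qN; lra.
move=> a x y; rewrite qD; congr (_ + _).
have [a0|a0] := leP 0 a; first exact: sublinearZ.
by rewrite -[a]opprK scaleNr qN sublinearZ ?oppr_ge0 ?(ltW a0)// !mulNr.
Qed.

(* A functional dominated by s and attaining it at x is a minimal sublinear *)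
(* functional below [sublinear_shift s x].                                  *)
Lemma hahn_banach s x : sublinear s ->
  exists q, [/\ linear_for *%R q, forall y, q y <= s y & q x = s x].
Proof.
move=> ss; have sx := sublinear_shift_sublinear x ss.
have [q [sq qs qmin]] := ex_minimal_sublinear sx.
have qle y : q y <= s y by exact: le_trans (qs y) (sublinear_shift_le_self _ ss y).
exists q; split=> //; first exact: minimal_sublinear_linear.
apply/eqP; rewrite eq_le qle/= -lerN2 -(minimal_sublinearN sq qmin).
exact: le_trans (qs _) (sublinear_shiftN _ ss).
Qed.

End HahnBanach.

Section DualBall.
Variables (R : realType) (X : normedModType R).

Definition dual_ball : set {linear X -> R^o} :=
  [set phi | forall x, `|phi x| <= `|x|].

Lemma dual_ball0 : dual_ball (\0 : {linear X -> R^o}).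
Proof. by move=> x /=; rewrite normr0. Qed.

Lemma norming_functional (x : X) :
  exists2 phi : {linear X -> R^o}, dual_ball phi & phi x = `|x|.
Proof.
have sN : sublinear (fun y : X => `|y|).
  by split=> [|a] *; [exact: ler_normD|rewrite normrZ ger0_norm].
have [q [ql qs qx]] := hahn_banach x sN.
pose qL := GRing.isLinear.Build R X R^o *:%R q ql.
pose phi : {linear X -> R^o} := HB.pack q qL.
exists phi => // y; rewrite ler_norml qs andbT lerNl.
by rewrite -[- _](linearN phi) -normrN qs.
Qed.

End DualBall.
Arguments dual_ball {R} X _.
Arguments dual_ball0 {R} X.

(** * Hilbert spaces by polarization *)

Section Polarization.
Variables (R : realType) (V : normedModType R).
Implicit Types x y : V.

(** The inner product as a function of the norm alone: it makes sense before the space is known to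
    be Hilbert and passes to completions by continuity. *)
Definition polar x y : R := (`|x + y| ^+ 2 - `|x - y| ^+ 2) / 4.

Definition linear_polar := forall y, linear_for *%R (polar^~ y).

Lemma polarC x y : polar x y = polar y x.
Proof. by rewrite /polar (addrC x) (distrC x). Qed.

Lemma polar0l y : polar 0 y = 0.
Proof. by rewrite /polar add0r sub0r normrN subrr mul0r. Qed.

Lemma polarNl x y : polar (- x) y = - polar x y.
Proof.
by rewrite /polar -opprD normrN (addrC (- x)) (distrC y) -[RHS]mulNr opprB.
Qed.

Lemma polar_self x : polar x x = `|x| ^+ 2.
Proof. by rewrite /polar subrr normr0 -mulr2n normrMn; field. Qed.

Lemma linear_polarZ a x y : linear_polar -> polar (a *: x) y = a * polar x y.
Proof. by move=> lp; rewrite -[a *: x]addr0 lp polar0l addr0. Qed.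

(** Cauchy-Schwarz in any normed space: both [|x + y|] and [|x - y|] lie between [||x| - |y||] and
    [|x| + |y|], and the squares of these bounds differ by [4 |x| |y|]. *)
Lemma ler_norm_polar x y : `|polar x y| <= `|x| * `|y|.
Proof.
have D : `|x + y| <= `|x| + `|y| by exact: ler_normD.
have B : `|x - y| <= `|x| + `|y| by rewrite -(normrN y) ler_normD.
have sq (a b : R) : 0 <= a -> a <= b -> a ^+ 2 <= b ^+ 2.
  by move=> a0 ab; rewrite ler_pXn2r// nnegrE// (le_trans a0).
have low z : (`|x| - `|z|) ^+ 2 <= `|x - z| ^+ 2.
  rewrite -[X in X <= _]real_normK ?num_real//.
  by rewrite sq// ler_dist_dist.
have := low y; have := low (- y); rewrite normrN opprK.
have := sq _ _ (normr_ge0 _) D; have := sq _ _ (normr_ge0 _) B.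
rewrite /polar ler_norml !sqrrD sqrrN; lra.
Qed.

Lemma polar_cvg (u v : nat -> V) x y : u @ \oo --> x -> v @ \oo --> y ->
  polar (u n) (v n) @[n --> \oo] --> polar x y.
Proof.
move=> ux vy; apply: cvgMl; apply: cvgB; rewrite !expr2.
  by apply: cvgM; apply: cvg_norm; exact: cvgD.
by apply: cvgM; apply: cvg_norm; exact: cvgB.
Qed.

End Polarization.

Section HilbertPolarization.
Variables (R : realType).

Lemma is_hilbert_polar (H : completeNormedModType R) :
  linear_polar H -> is_hilbert H.
Proof.
move=> lp.
have bl : bilinear_for (GRing.Scale.Law.clone _ _ *%R _)
    (GRing.Scale.Law.clone _ _ (idfun \; *%R) _) (@polar R H).
  split=> [y|x]; first exact: lp.
  by move=> a y z /=; rewrite ![polar x _]polarC lp.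
pose hB := bilinear_isBilinear.Build R H H R _ _ (@polar R H) bl.
have hs (x y : H) : polar x y = (-1) ^+ false * idfun (polar y x).
  by rewrite expr0 mul1r polarC.
pose hH := isHermitianSesquilinear.Build R H false idfun (@polar R H) hs.
have pos (x : H) : x != 0 -> 0 < polar x x.
  by move=> x0; rewrite polar_self exprn_gt0// normr_gt0.
pose hD := isDotProduct.Build R H (@polar R H) pos.
pose ip : {dot H for idfun} := HB.pack (@polar R H) hB hH hD.
by exists ip => x; rewrite -polar_self.
Qed.

Variable H0 : normedModType R.

Definition norm_seminorm : seminorm H0 := Seminorm (@ler_normD R H0) (@normrZ R H0).

Lemma polar_completion_embed (x y : H0) :
  polar (completion_embed norm_seminorm x) (completion_embed norm_seminorm y) =
  polar x y.
Proof. by rewrite /polar -raddfD -raddfB !norm_completion_embed. Qed.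

(** Both sides of the linearity identity are limits of the same identity along Cauchy sequences in
    the dense subspace. *)
Lemma linear_polar_completion :
  linear_polar H0 -> linear_polar (completion norm_seminorm).
Proof.
move=> lp z a x y; rewrite -[x]to_completion_repr -[y]to_completion_repr.
rewrite -[z]to_completion_repr.
set u := repr x; set v := repr y; set w := repr z.
have cu := @completion_embed_cvg R H0 norm_seminorm u.
have cv := @completion_embed_cvg R H0 norm_seminorm v.
have cw := @completion_embed_cvg R H0 norm_seminorm w.
have h1 : (fun n => polar (a *: u n + v n) (w n)) @ \oo -->
    polar (a *: to_completion u + to_completion v) (to_completion w).
  under eq_fun do rewrite -polar_completion_embed linearP.
  by apply: polar_cvg cw; apply: cvgD cv; exact: cvgZr.
have h2 : (fun n => polar (a *: u n + v n) (w n)) @ \oo -->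
    a * polar (to_completion u) (to_completion w) +
    polar (to_completion v) (to_completion w).
  under eq_fun do rewrite lp -!polar_completion_embed.
  by apply: cvgD (polar_cvg cv cw); apply: cvgMr; exact: polar_cvg.
exact: cvg_unique h1 h2.
Qed.

End HilbertPolarization.

Section Ell2.
Variables (R : realType) (J : choiceType) (ge1_2 : 1 <= 2 :> R).
Implicit Types f g h : ell J ge1_2.

Lemma ell2_normE f : (`|f| ^+ 2)%:E = (\esum_(j in [set: J]) ((f j) ^+ 2)%:E)%E.
Proof.
rewrite -powR_mulrn// -[(_ `^ _)%:E](ell_sumE f); apply: eq_esum => j _.
by rewrite powR_mulrn// real_normK// num_real.
Qed.

Let esum_sqr_comb a (F G H : R) f g h : 0 <= a ->
  F%:E = (\esum_(j in [set: J]) ((f j) ^+ 2)%:E)%E ->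
  G%:E = (\esum_(j in [set: J]) ((g j) ^+ 2)%:E)%E ->
  H%:E = (\esum_(j in [set: J]) ((h j) ^+ 2)%:E)%E ->
  (F + a * G + H)%:E =
  (\esum_(j in [set: J]) ((f j) ^+ 2 + a * (g j) ^+ 2 + (h j) ^+ 2)%:E)%E.
Proof.
move=> a0 FE GE HE; rewrite 2!EFinD EFinM FE GE HE -esum_pZl//; last first.
  by move=> j; rewrite lee_fin sqr_ge0.
rewrite -esumD; last 2 first.
- by move=> j _; rewrite lee_fin sqr_ge0.
- by move=> j _; rewrite mule_ge0// lee_fin sqr_ge0.
rewrite -esumD//; last first.
- by move=> j _; rewrite lee_fin sqr_ge0.
- by move=> j _; rewrite adde_ge0 ?mule_ge0// lee_fin sqr_ge0.
Qed.

(** The negative terms of the identity are moved across, so that for [a >= 0] only sums of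
    nonnegative terms are compared, coordinate by coordinate; a negative scalar is absorbed into the
    sign of x. *)
Lemma linear_polar_ell2 : linear_polar (ell J ge1_2).
Proof.
have alg (a m1 m2 m3 n1 n2 n3 : R) : n1 + a * n2 + n3 = m1 + a * m2 + m3 ->
  (n1 - m1) / 4 = a * ((m2 - n2) / 4) + (m3 - n3) / 4 by lra.
have pos a (x y z : ell J ge1_2) : 0 <= a ->
    polar (a *: x + y) z = a * polar x z + polar y z :> R.
  move=> a0; apply: alg; apply: EFin_inj.
  apply: etrans (esum_sqr_comb a0 (ell2_normE _) (ell2_normE _) (ell2_normE _)) _.
  apply/esym.
  apply: etrans (esum_sqr_comb a0 (ell2_normE _) (ell2_normE _) (ell2_normE _)) _.
  apply: eq_esum => j _.
  have ring_id (r s t : R) : (a * r + s - t) ^+ 2 + a * (r + t) ^+ 2 + (s + t) ^+ 2 =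
    (a * r + s + t) ^+ 2 + a * (r - t) ^+ 2 + (s - t) ^+ 2 by ring.
  exact: congr1 (ring_id (x j) (y j) (z j)).
move=> z a x y; have [a0|a0] := leP 0 a; first exact: pos.
have na0 : 0 <= - a by rewrite oppr_ge0 ltW.
rewrite -[a]opprK scaleNr -scalerN mulNr -mulrN -polarNl; exact: pos.
Qed.

End Ell2.

(** * Unit vectors of l_p *)

Section ClosedSubspace.
Variables (R : realType) (X : normedModType R).

Definition closed_subspace (A : set X) := [/\ A 0,
  forall a x y, A x -> A y -> A (a *: x + y) &
  forall x, (forall d, 0 < d -> exists2 y, A y & `|x - y| <= d) -> A x].

(** Density of the linear span, phrased as an induction principle. *)
Definition total (I : Type) (e : I -> X) :=
  forall A, closed_subspace A -> (forall i, A (e i)) -> forall x, A x.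

End ClosedSubspace.

Lemma powR_le_root (R : realType) (p a b : R) : 0 < p -> 0 <= a ->
  a `^ p <= b -> a <= b `^ p^-1.
Proof.
move=> p0 a0 ab; have -> : a = (a `^ p) `^ p^-1.
  by rewrite -powRrM mulfV ?gt_eqF// powRr1.
by apply: ge0_ler_powR => //; rewrite ?nnegrE ?invr_ge0 ?(ltW p0) ?powR_ge0//;
  exact: le_trans (powR_ge0 _ _) ab.
Qed.

Section EllDelta.
Variables (R : realType) (I : choiceType) (p : R) (p1 : 1 <= p).
Implicit Types (f x : ell I p1) (s : seq I).

Let p0 : 0 < p. Proof. exact: lt_le_trans p1. Qed.

Lemma ell_sum_le_size (f : I -> R) s : (forall i, `|f i| <= (i \in s)%:R) ->
  (ell_sum p f <= (size s)%:R%:E)%E.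
Proof.
move=> fs; rewrite (@le_trans _ _ (\esum_(i in [set` s]) 1%:E)%E)//.
  rewrite esum_mkcond; apply: le_esum => i _; case: ifPn => [|].
    rewrite inE/= => si; rewrite lee_fin; have := fs i; rewrite si => f1.
    rewrite [leRHS](_ : _ = 1 `^ p); last by rewrite powR1.
    by apply: ge0_ler_powR; rewrite ?nnegrE ?(ltW p0).
  rewrite notin_setE/= => /negP/negbTE si; have := fs i.
  by rewrite si normr_le0 => /eqP->; rewrite normr0 powR0// gt_eqF.
rewrite esum_fset//.
rewrite (_ : [set` s] = [set` undup s]); last first.
  by apply/seteqP; split => i /=; rewrite mem_undup.
rewrite -fsbig_seq ?undup_uniq//= sumEFin lee_fin.
by rewrite big_const_seq count_predT iter_addr_0 ler_nat size_undup.
Qed.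

Lemma ell_norm_le_size f s : (forall i, `|f i| <= (i \in s)%:R) ->
  `|f| <= (size s)%:R `^ p^-1.
Proof.
move=> /ell_sum_le_size; rewrite ell_sumE lee_fin => h.
exact: powR_le_root.
Qed.

Fact ell_delta_subproof i :
  (fun j : I => (j == i)%:R : R^o) \in is_ell p.
Proof.
rewrite inE; apply: le_lt_trans (ltry 1%:R); apply: (@ell_sum_le_size _ [:: i]).
by move=> j; rewrite inE normr_nat.
Qed.

Definition ell_delta i : ell I p1 := Ell p1 (ell_delta_subproof i).

Lemma ell_deltaE i j : ell_delta i j = (j == i)%:R.
Proof. by []. Qed.

Lemma norm_ell_delta_le1 i : `|ell_delta i| <= 1.
Proof.
rewrite [leRHS](_ : _ = (size [:: i])%:R `^ p^-1); last by rewrite powR1.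
apply: (@ell_norm_le_size _ [:: i]) => j.
by rewrite ell_deltaE inE normr_nat.
Qed.

(** Some finite partial sum of [|x i|^p] comes within [d^p] of the total; the rest is the p-th power
    of the norm of the discarded tail. *)
Lemma ell_truncation x (d : R) : 0 < d -> exists s (y : ell I p1),
  (forall i, i \notin s -> y i = 0) /\ `|x - y| <= d.
Proof.
move=> d0; have xp : ell_sum p x \is a fin_num by rewrite ell_sumE.
have dp0 : 0 < d `^ p by rewrite powR_gt0.
have [_ [_ [/finite_seqP[s ->] _] <-] hA] := ub_ereal_sup_adherent dp0 xp.
pose t i : R^o := if i \in s then x i else 0.
have tE : t \in is_ell p.
  rewrite inE; apply: le_lt_trans (_ : (ell_sum p x < +oo)%E); last first.
    by rewrite ell_sumE ltry.
  apply: le_esum => i _; rewrite lee_fin /t; case: ifP => // _.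
  by rewrite normr0 powR0 ?powR_ge0// gt_eqF.
exists s, (Ell p1 tE); split=> [i /negbTE si|]; first by rewrite /= /t si.
have a0 i : [set: I] i -> (0 <= (`|x i| `^ p)%:E)%E by rewrite lee_fin powR_ge0.
have tail : (ell_sum p (x - Ell p1 tE)%R <= (d `^ p)%:E)%E.
  have -> : ell_sum p (x - Ell p1 tE)%R =
      (\esum_(i in [set: I] `&` ~` [set` s]) (`|x i| `^ p)%:E)%E.
    rewrite setTI esum_mkcond; apply: eq_esum => i _.
    rewrite -[(x - _) i]/(x i - t i) /t in_setC mem_setE.
    case: (i \in s) => /=; last by rewrite subr0.
    by rewrite subrr normr0 powR0// gt_eqF.
  have := xp; move: hA; rewrite -[ereal_sup _]/(ell_sum p x).
  have -> : ell_sum p x = _ := esumID [set` s] _ _ a0.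
  rewrite setTI (esum_fset (finite_seq s))//.
  set S := (\sum_(i \in _) _)%E; set T := (\esum_(i in _) _)%E.
  rewrite fin_numD => + /andP[]; move: S T => [u| |] [v| |]// + _ _.
  rewrite -EFinD lte_fin lee_fin => h.
  by apply/ltW; lra.
move: tail; rewrite ell_sumE lee_fin => /powR_le_root.
rewrite -powRrM mulfV ?gt_eqF// powRr1 ?(ltW d0)//.
by apply => //; exact: powR_ge0.
Qed.

Lemma total_ell_delta : total ell_delta.
Proof.
move=> A [A0 AD Ac] Ae x.
have As s : forall y : ell I p1, (forall i, i \notin s -> y i = 0) -> A y.
  elim: s => [|i s IH] y ys.
    rewrite (_ : y = 0)//; apply/val_inj/funext => i; exact: ys.
  rewrite -(subrK (y i *: ell_delta i) y) addrC; apply: AD => //.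
  apply: IH => j js; change (y j - y i * (j == i)%:R = 0).
  have [->|ji] := eqVneq j i; first by rewrite mulr1 subrr.
  by rewrite mulr0 subr0 ys// inE negb_or ji.
apply: Ac => d d0; have [s [y [ys xy]]] := ell_truncation x d0.
by exists y => //; exact: As ys.
Qed.

End EllDelta.

(** The squared norms of [delta + w] and [delta - w] share the tail [T] off j, so only
    [(1 + w j)^2 - (1 - w j)^2 = 4 w j] remains. *)
Lemma polar_ell_delta (R : realType) (J : choiceType) (ge1_2 : 1 <= 2 :> R)
  (w : ell J ge1_2) j : polar (ell_delta ge1_2 j) w = w j.
Proof.
pose T := (\esum_(i in [set: J] `&` ~` [set j]) ((w i) ^+ 2)%:E)%E.
have split_norm (f : ell J ge1_2) :
    (forall i, i != j -> (f i) ^+ 2 = (w i) ^+ 2) ->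
    (`|f| ^+ 2)%:E = (((f j) ^+ 2)%:E + T)%E.
  move=> fw; apply: etrans (ell2_normE f) _.
  have f0 i : [set: J] i -> (0 <= ((f i) ^+ 2)%:E)%E by rewrite lee_fin sqr_ge0.
  apply: etrans (esumID [set j] _ _ f0) _; congr (_ + _)%E.
    by rewrite setTI esum_set1// lee_fin sqr_ge0.
  by apply: eq_esum => i [_ /eqP ij]; rewrite fw.
have alg (F G a : R) (S : \bar R) : F%:E = (((1 + a) ^+ 2)%:E + S)%E ->
    G%:E = (((1 - a) ^+ 2)%:E + S)%E -> (F - G) / 4 = a.
  case: S => [t| |] E1 E2; last 2 first.
  - by have := congr1 (fun e => e == +oo%E) E1.
  - by have := congr1 (fun e => e == -oo%E) E1.
  by have /= -> := congr1 fine E1; have /= -> := congr1 fine E2; field.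
apply: (alg _ _ _ T).
  apply: etrans (split_norm _ _) _ => [i ij|].
    by change (((i == j)%:R + w i) ^+ 2 = (w i) ^+ 2); rewrite (negbTE ij) add0r.
  by change ((((j == j)%:R + w j) ^+ 2)%:E + T = ((1 + w j) ^+ 2)%:E + T)%E;
    rewrite eqxx.
apply: etrans (split_norm _ _) _ => [i ij|].
  by change (((i == j)%:R - w i) ^+ 2 = (w i) ^+ 2); rewrite (negbTE ij) sub0r sqrrN.
by change ((((j == j)%:R - w j) ^+ 2)%:E + T = ((1 - w j) ^+ 2)%:E + T)%E;
    rewrite eqxx.
Qed.

(** * Subspaces of Hilbert generated spaces *)

Lemma bounded_linear_cts (R : realType) (V W : normedModType R)
  (f : {linear V -> W}) (k : R) : (forall x, `|f x| <= k * `|x|) -> continuous f.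
Proof.
move=> fk x; apply/cvgrPdist_le => e e0.
have k0 : 0 < `|k| + 1 by rewrite ltr_wpDl.
near=> y; rewrite -linearB (le_trans (fk _))//.
rewrite (@le_trans _ _ ((`|k| + 1) * `|x - y|))//.
  by rewrite ler_wpM2r// (le_trans (ler_norm k))// lerDl.
rewrite -ler_pdivlMl// mulrC.
near: y; apply: cvgr_dist_le; first exact: cvg_id.
by rewrite divr_gt0.
Unshelve. all: by end_near. Qed.

(** Preimages of approximants of a limit point form a Cauchy sequence, which converges since X is
    complete. *)
Lemma isometry_closed_range (R : realType) (X Y : completeNormedModType R)
  (J : {linear X -> Y}) : (forall x, `|J x| = `|x|) -> closed (range J).
Proof.
move=> JN y cly.
have h n : exists x, `|y - J x| < n.+1%:R^-1.
  have n0 : 0 < n.+1%:R^-1 :> R by rewrite invr_gt0.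
  have [_ [[x _ <-] xy]] := cly _ (nbhsx_ballx y _ n0).
  by exists x; move: xy; rewrite -ball_normE.
have {h} [u hu] := choice h.
have uc : cvgn u.
  apply/cauchy_cvgP/cauchy_exP => e e0.
  have [N _ hN] := near_infty_natSinv_lt (PosNum (divr_gt0 e0 (ltr0n R 2))).
  exists (u N); exists N => // n /= Nn; rewrite -ball_normE /= -JN linearB.
  rewrite -(subrKA y) (le_lt_trans (ler_normD _ _))// (splitr e) ltrD//.
    by rewrite distrC (lt_trans (hu _)) ?hN//=.
  by rewrite (lt_trans (hu _))// hN.
exists (limn u) => //; apply/eqP; rewrite -subr_eq0 -normr_le0.
apply/ler_addgt0Pr => e e0; rewrite add0r (splitr e).
near \oo => n.
rewrite -(subrKA (J (u n))) (le_trans (ler_normD _ _))// lerD//.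
  rewrite -linearB JN.
  near: n; apply: cvgr_dist_le; first exact: uc.
  by rewrite divr_gt0.
rewrite distrC ltW// (lt_trans (hu n))//.
near: n; exact: (near_infty_natSinv_lt (PosNum (divr_gt0 e0 (ltr0n R 2)))).
Unshelve. all: by end_near. Qed.

Lemma isometry_inverse (R : realType) (X Y : completeNormedModType R)
  (J : {linear X -> Y}) : (forall x, `|J x| = `|x|) ->
  exists K : Y -> X, cancel J K /\ {within range J, continuous K}.
Proof.
move=> JN.
have Jinj : injective J.
  move=> x y /eqP; rewrite -subr_eq0 -linearB -normr_eq0 JN normr_eq0 subr_eq0.
  by move/eqP.
(* Off the range [K] takes the default value 0; continuity is only asked within the range. *)
pose K y := xget 0 [set x | J x = y].
have JK : cancel J K.
  by move=> x; rewrite /K; case: xgetP => [y _ /= /Jinj//|/(_ x) /=]; case.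
exists K; split=> //; apply/subspace_continuousP => _ [x _ <-].
apply/cvgrPdist_le => e e0; rewrite near_withinE; near=> z.
move=> [x' _ x'z]. rewrite -x'z /from_subspace (JK x) (JK x') -JN linearB x'z.
near: z; apply: cvgr_dist_le e0; exact: cvg_id.
Unshelve. all: by end_near. Qed.

Section Amalgam.
Variables (R : realType) (X H : completeNormedModType R).
Variables (w : {linear X -> R^o} -> H) (M : R).
Hypothesis lp : linear_polar H.
Hypothesis wM : forall phi, dual_ball X phi -> `|w phi| <= M.

Let pairing (phi : {linear X -> R^o}) (z : X * H) : R :=
  phi z.1 + polar z.2 (w phi).

(* The sup norm of the function phi |-> phi x + <a, w phi> on the dual ball.   *)
(* Completing X * H for this seminorm realizes, inside the bounded functions  *)
(* on the dual ball, the closed span of X and of the image of H.              *)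
Definition amalgam_fun (z : X * H) : R :=
  sup [set `|pairing phi z| | phi in dual_ball X].

Let pairingP phi a y z :
  pairing phi (a *: y + z) = a * pairing phi y + pairing phi z.
Proof. by rewrite /pairing /= linearP lp mulrDr addrACA. Qed.

Let pairing_le phi z : dual_ball X phi -> `|pairing phi z| <= `|z.1| + M * `|z.2|.
Proof.
move=> hphi; rewrite (le_trans (ler_normD _ _))// lerD ?hphi//.
by rewrite (le_trans (ler_norm_polar _ _))// mulrC ler_wpM2r// wM.
Qed.

Lemma amalgam_fun_ge phi z : dual_ball X phi -> `|pairing phi z| <= amalgam_fun z.
Proof.
move=> hphi; apply: ub_le_sup; last by exists phi.
by exists (`|z.1| + M * `|z.2|) => _ [psi hpsi <-]; exact: pairing_le.
Qed.

Lemma amalgam_fun_le z c :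
  (forall phi, dual_ball X phi -> `|pairing phi z| <= c) -> amalgam_fun z <= c.
Proof.
move=> h; apply: ge_sup => [|_ [phi hphi <-]]; last exact: h.
by exists `|pairing \0 z|, \0 => //; exact: dual_ball0.
Qed.

Lemma amalgam_fun_ge0 z : 0 <= amalgam_fun z.
Proof. exact: le_trans (normr_ge0 _) (amalgam_fun_ge z (dual_ball0 X)). Qed.

Lemma amalgam_funD y z : amalgam_fun (y + z) <= amalgam_fun y + amalgam_fun z.
Proof.
apply: amalgam_fun_le => phi hphi.
rewrite -[y]scale1r pairingP mul1r scale1r (le_trans (ler_normD _ _))//.
by rewrite lerD ?amalgam_fun_ge.
Qed.

Lemma amalgam_funZ a z : amalgam_fun (a *: z) = `|a| * amalgam_fun z.
Proof.
have le b y : amalgam_fun (b *: y) <= `|b| * amalgam_fun y.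
  apply: amalgam_fun_le => phi hphi.
  have -> : pairing phi (b *: y) = b * pairing phi y.
    by rewrite /pairing /= linearZ linear_polarZ// mulrDr.
  by rewrite normrM ler_wpM2l// amalgam_fun_ge.
apply/eqP; rewrite eq_le le /=.
have [->|a0] := eqVneq a 0; first by rewrite normr0 mul0r amalgam_fun_ge0.
rewrite -ler_pdivlMl ?normr_gt0// -normfV.
by have := le a^-1 (a *: z); rewrite scalerA mulVf// scale1r.
Qed.

Definition amalgam : seminorm (X * H)%type := Seminorm amalgam_funD amalgam_funZ.

Let Y := completion amalgam.

Fact amalgam_inl_linear : linear (fun x : X => completion_embed amalgam (x, 0) : Y).
Proof.
move=> a x y; rewrite -linearP; congr completion_embed.
by congr pair; rewrite /= ?scaler0 ?addr0.
Qed.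

Fact amalgam_inr_linear : linear (fun x : H => completion_embed amalgam (0, x) : Y).
Proof.
move=> a x y; rewrite -linearP; congr completion_embed.
by congr pair; rewrite /= ?scaler0 ?addr0.
Qed.

Lemma amalgam_inl_norm (x : X) : `|completion_embed amalgam (x, 0)| = `|x|.
Proof.
have p0 phi : pairing phi (x, 0) = phi x by rewrite /pairing /= polar0l addr0.
rewrite norm_completion_embed /=; apply/eqP; rewrite eq_le; apply/andP; split.
  by apply: amalgam_fun_le => phi hphi; rewrite p0 hphi.
have [phi hphi phix] := norming_functional x.
by have := amalgam_fun_ge (x, 0) hphi; rewrite p0 phix normr_id.
Qed.

Lemma amalgam_inr_norm (x : H) : `|completion_embed amalgam (0, x)| <= M * `|x|.
Proof.
rewrite norm_completion_embed /=; apply: amalgam_fun_le => phi hphi.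
by have := pairing_le (0, x) hphi; rewrite normr0 add0r.
Qed.

(** X embeds in the completed amalgam by [x |-> (x, 0)], isometrically, and H maps to it by
    [a |-> (0, a)], boundedly; uniform approximability is what makes the image of H dense. *)
Lemma subspace_of_hilbert_generated_pairing :
  (forall x e, 0 < e -> exists a, forall phi, dual_ball X phi ->
    `|phi x - polar a (w phi)| <= e) ->
  subspace_of_hilbert_generated X.
Proof.
move=> approx.
pose J : {linear X -> Y} := HB.pack (fun x : X => completion_embed amalgam (x, 0) : Y)
  (GRing.isLinear.Build R X Y *:%R _ amalgam_inl_linear).
pose T : {linear H -> Y} := HB.pack (fun x : H => completion_embed amalgam (0, x) : Y)
  (GRing.isLinear.Build R H Y *:%R _ amalgam_inr_linear).
have JN x : `|J x| = `|x| by exact: amalgam_inl_norm.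
exists Y; split; last first.
  exists J; split.
  - by apply: (@bounded_linear_cts _ _ _ _ 1) => x; rewrite JN mul1r.
  - exact: isometry_closed_range.
  - exact: isometry_inverse.
exists H; split; first exact: is_hilbert_polar.
exists T; split; first by apply: (@bounded_linear_cts _ _ _ T M) => x;
  exact: amalgam_inr_norm.
move=> O O0 oO; have [z [Oz [[x a] _ zE]]] := completion_embed_dense O0 oO.
have := open_nbhs_nbhs (conj oO Oz); rewrite -nbhs_ballE => -[e /= e0 eO].
have e20 : 0 < e / 2 by rewrite divr_gt0.
have [b hb] := approx x _ e20.
(* The difference of [(x, a)] and [(0, a + b)] pairs with phi to [phi x - polar b (w phi)], which is
   at most [e / 2] in modulus. *)
exists (T (a + b)); split; last by exists (a + b).
apply: eO; rewrite -ball_normE /= -zE -linearB norm_completion_embed.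
apply: le_lt_trans (_ : _ <= e / 2) _; last first.
  by rewrite ltr_pdivrMr// mulr_natr mulr2n ltrDl.
apply: amalgam_fun_le => phi hphi; rewrite /pairing /= subr0 opprD addNKr.
have -> : polar (- b) (w phi) = - polar b (w phi) by exact: polarNl.
exact: hb.
Qed.

End Amalgam.

(** * From uniform counts of large coordinates to Hilbert generation *)

Section UniformCount.
Variables (R : realType) (X : completeNormedModType R) (I : choiceType).
Variable e : I -> X.
Hypothesis e_le1 : forall i, `|e i| <= 1.
Hypothesis e_total : total e.
Hypothesis e_count : forall d : R, 0 < d -> exists N : nat,
  forall phi, dual_ball X phi -> forall s : seq I, uniq s ->
  (forall i, i \in s -> d <= `|phi (e i)|) -> (size s <= N)%N.

Let ge1_2 : 1 <= 2 :> R. Proof. by rewrite ler1n. Qed.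

Let level (n : nat) : R := n.+1%:R^-1.

(* Level n recovers phi (e i) up to an error 1 / n.+1, and only boundedly many *)
(* indices i survive the truncation.                                          *)
Let weight (c : nat -> R) (phi : {linear X -> R^o}) (n : nat) (i : I) : R :=
  if level n <= `|phi (e i)| then c n * phi (e i) else 0.

(** At most N terms survive the truncation, and each is at most [c n ^+ 2] because
    [|phi (e i)| <= |e i| <= 1]. *)
Let esum_count (n N : nat) (c : nat -> R) (phi : {linear X -> R^o}) : dual_ball X phi ->
  (forall s : seq I, uniq s ->
    (forall i, i \in s -> level n <= `|phi (e i)|) -> (size s <= N)%N) ->
  (\esum_(i in [set: I])
(`|weight c phi n i| `^ 2)%:E <= (c n ^+ 2 * N%:R)%:E)%E.
Proof.
move=> hphi hN; apply: ge_ereal_sup => _ [_ [/finite_seqP[s ->] _] <-].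
rewrite (_ : [set` s] = [set` undup s]); last first.
  by apply/seteqP; split => i /=; rewrite mem_undup.
rewrite -fsbig_seq ?undup_uniq//= sumEFin lee_fin.
pose big i := level n <= `|phi (e i)|.
rewrite (@le_trans _ _ (\sum_(i <- undup s) (if big i then c n ^+ 2 else 0)))//.
  apply: ler_sum => i _; rewrite powR_mulrn// /weight -/(big i); case: ifP => _.
    rewrite normrM exprMn real_normK ?num_real// ler_piMr ?sqr_ge0//.
    by rewrite expr_le1// (le_trans (hphi _)).
  by rewrite normr0 expr0n.
rewrite -big_mkcond -big_filter big_const_seq count_predT iter_addr_0.
rewrite -[leLHS]mulr_natr ler_wpM2l ?sqr_ge0// ler_nat hN ?filter_uniq ?undup_uniq//.
by move=> i; rewrite mem_filter => /andP[].
Qed.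

Let weights_exist : exists c : nat -> R, (forall n, 0 < c n) /\
  forall phi, dual_ball X phi -> 
    (ell_sum 2 (fun z : nat * I => weight c phi z.1 z.2) <= 1)%E.
Proof.
have lev0 n : 0 < level n by rewrite invr_gt0.
have [N hN] := choice (fun n => e_count (lev0 n)).
(* With this choice level n contributes at most [1 / 2^(n+1)], and the levels together at most 1.
   The successor of [N n] keeps the weight positive when [N n] is 0. *)
pose c n : R := (2 ^+ n.+1 * (N n).+1%:R)^-1.
have c0 n : 0 < c n by rewrite invr_gt0 mulr_gt0// exprn_gt0.
have cN n : c n ^+ 2 * (N n)%:R <= 1 / (2 ^ n.+1)%:R.
  have p0 : 1 <= 2 ^+ n.+1 :> R by rewrite exprn_ege1// ler1n.
  have p00 := lt_le_trans ltr01 p0.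
  have N0 : 0 <= (N n)%:R :> R by [].
  rewrite natrX /c; move: p0 p00 N0; rewrite -[(N n).+1%:R]natr1.
  move: (2 ^+ n.+1) (N n)%:R => x y x1 x0 y0.
  have y10 : 0 < y + 1 by rewrite ltr_wpDl.
  rewrite exprVn mulrC ler_pdivrMr ?exprn_gt0 ?mulr_gt0//.
  have xE : x != 0 by rewrite gt_eqF.
  have -> : 1 / x * (x * (y + 1)) ^+ 2 = x * (y + 1) ^+ 2 by field.
  apply: (@le_trans _ _ (1 * (y + 1) ^+ 2)); first by nra.
  by rewrite ler_wpM2r ?sqr_ge0.
exists c; split=> // phi hphi; rewrite /ell_sum.
rewrite (_ : [set: nat * I] = [set: nat] `*`` (fun=> [set: I])); last first.
  by apply/seteqP; split.
rewrite -(@esum_esum _ _ _ _ _ (fun n i => (`|weight c phi n i| `^ 2)%:E)); last first.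
  by move=> *; rewrite lee_fin powR_ge0.
apply: (@le_trans _ _ (\esum_(n in [set: nat]) (1 / (2 ^ n.+1)%:R)%:E)%E).
  apply: le_esum => n _; apply: le_trans (esum_count c hphi (hN n phi hphi)) _.
  by rewrite lee_fin.
rewrite -nneseries_esumT; last by move=> n; rewrite lee_fin divr_ge0.
exact: (epsilon_trick0 xpredT ler01).
Qed.

Let H := completion (norm_seminorm (ell (nat * I)%type ge1_2)).
Let d (n : nat) (i : I) : H :=
  completion_embed (norm_seminorm _) (ell_delta ge1_2 (n, i)).

Let H_linear_polar : linear_polar H.
Proof. exact: linear_polar_completion (@linear_polar_ell2 _ _ _). Qed.

Let vectors_exist : exists (c : nat -> R) (w : {linear X -> R^o} -> H),
  (forall n, 0 < c n) /\
  forall phi, dual_ball X phi -> `|w phi| <= 1 /\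
    forall n i, polar (d n i) (w phi) = weight c phi n i.
Proof.
have [c [c0 hc]] := weights_exist.
suff /choice[w hw] : forall phi, exists v : H, dual_ball X phi -> `|v| <= 1 /\
    forall n i, polar (d n i) v = weight c phi n i by exists c, w.
move=> phi; have [hphi|] := pselect (dual_ball X phi); last by exists 0.
pose f : nat * I -> R^o := fun z => weight c phi z.1 z.2.
have f1 : (ell_sum 2 f <= 1)%E by exact: hc.
have fE : f \in is_ell 2 by rewrite inE (le_lt_trans f1)// ltry.
exists (completion_embed (norm_seminorm _) (Ell ge1_2 fE)) => _; split.
  apply: le_trans (_ : ell_norm (Ell ge1_2 fE) <= 1).
    by rewrite norm_completion_embed.
  move: f1; rewrite -[ell_sum 2 f]/(ell_sum 2 (Ell ge1_2 fE)) ell_sumE lee_fin.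
  by move=> /(powR_le_root (ltr0n _ 2) (ell_norm_ge0 _)); rewrite powR1.
by move=> n i; apply: etrans (polar_completion_embed _ _) (polar_ell_delta _ _).
Qed.

Lemma subspace_of_hilbert_generated_count : subspace_of_hilbert_generated X.
Proof.
have [c [w [c0 hw]]] := vectors_exist.
apply: (@subspace_of_hilbert_generated_pairing _ X H w 1 H_linear_polar).
  by move=> phi /hw[].
(* The points whose evaluation is a uniform limit of pairings form a closed subspace, so by totality
   it is enough to treat the [e i]. *)
pose A := [set x : X | forall r : R, 0 < r -> exists a : H, forall phi,
  dual_ball X phi -> `|phi x - polar a (w phi)| <= r].
suff : forall x, A x by [].
apply: e_total.
  split.
  - move=> r r0; exists 0 => phi _; rewrite polar0l linear0 subr0 normr0.
    exact: ltW.
  - move=> k x y hx hy r r0.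
    have k0 : 0 < `|k| + 1 by rewrite ltr_wpDl.
    have r20 : 0 < r / 2 by rewrite divr_gt0.
    have [a ha] := hx _ (divr_gt0 r20 k0); have [b hb] := hy _ r20.
    exists (k *: a + b) => phi hphi; rewrite H_linear_polar linearP opprD addrACA.
    rewrite -mulrBr (le_trans (ler_normD _ _))// (splitr r) lerD ?hb//.
    rewrite normrM (le_trans (ler_wpM2l (normr_ge0 _) (ha _ hphi)))//.
    rewrite mulrCA ler_piMr ?(ltW r20)// ler_pdivrMr// mul1r lerDl//.
  - move=> x hx r r0; have r20 : 0 < r / 2 by rewrite divr_gt0.
    have [y hy xy] := hx _ r20; have [a ha] := hy _ r20.
    exists a => phi hphi; rewrite -(subrKA (phi y)) (splitr r).
    rewrite (le_trans (ler_normD _ _))// lerD ?ha// -linearB.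
    exact: le_trans (hphi _) xy.
(* Pick a level with [1/(n+1) < r]. Dividing by [c n] undoes the weight: the pairing is exactly
   [phi (e i)] when this entry survives the truncation, and otherwise 0, where [|phi (e i)|] is
   itself below r. *)
move=> i r r0; have [n _ /(_ _ (leqnn _)) hn] := near_infty_natSinv_lt (PosNum r0).
exists ((c n)^-1 *: d n i) => phi hphi; have [_ hd] := hw _ hphi.
rewrite linear_polarZ// hd /weight; case: (leP (level n)) => [_|hl].
  by rewrite mulrA mulVf ?gt_eqF// mul1r subrr normr0 ltW.
by rewrite mulr0 subr0 ltW// (lt_trans hl).
Qed.

End UniformCount.

(** * Counting the large entries of a bilinear form *)

(** Greedy choice: keeping one entry and deleting everything in its row or column costs at most
    [2 k] entries. *)
Lemma ex_matching (T U : eqType) (S : seq (T * U)) (k : nat) :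
  (forall t, (count (fun z => z.1 == t) S <= k)%N) ->
  (forall u, (count (fun z => z.2 == u) S <= k)%N) ->
  exists M : seq (T * U), [/\ {subset M <= S}, uniq (map fst M), uniq (map snd M) &
    (size S <= (k + k) * size M)%N].
Proof.
have [n] := ubnP (size S); elim: n S => // n IH [|z S] Sn S1 S2.
  by exists [::]; split.
pose a y := (y.1 == z.1) || (y.2 == z.2) : bool.
have cnt (b : pred (T * U)) :
    (count b [seq y <- z :: S | predC a y] <= count b (z :: S))%N.
  by rewrite count_filter; apply: sub_count => y /andP[].
have [|||M [MS M1 M2 MM]] := IH ([seq y <- z :: S | predC a y]).
- rewrite /= {1}/a eqxx /= (leq_ltn_trans (size_subseq (filter_subseq _ _)))//.
- by move=> t; apply: leq_trans (cnt _) (S1 t).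
- by move=> u; apply: leq_trans (cnt _) (S2 u).
have Ma y : y \in M -> ~~ a y by move=> /MS; rewrite mem_filter => /andP[].
exists (z :: M); split.
- move=> y; rewrite inE => /predU1P[->|/MS]; first exact: mem_head.
  by rewrite mem_filter => /andP[].
- rewrite /= M1 andbT; apply/mapP => -[y /Ma + zy].
  by rewrite /a zy eqxx.
- rewrite /= M2 andbT; apply/mapP => -[y /Ma + zy].
  by rewrite /a zy eqxx orbT.
rewrite [size (z :: M)]/= mulnS -(count_predC a) leq_add//; last first.
  by rewrite -size_filter.
apply: leq_trans (leq_add (S1 z.1) (S2 z.2)).
rewrite -(count_predUI (fun y => y.1 == z.1) (fun y => y.2 == z.2)).
exact: leq_addr.
Qed.

(** For positive n the inequality says [n^(1 - r) <= 1/d], hence [n <= (1/d)^(1/(1 - r))]. *)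
Lemma sublinear_growth_bound (R : realType) (d r : R) : 0 < d -> r < 1 ->
  exists N : nat, forall n : nat, d * n%:R <= n%:R `^ r -> (n <= N)%N.
Proof.
move=> d0 r1; have r10 : 0 < 1 - r by rewrite subr_gt0.
have c0 : 0 <= d^-1 `^ (1 - r)^-1 by exact: powR_ge0.
exists (Num.bound (d^-1 `^ (1 - r)^-1)) => -[//|n] h.
rewrite ltnW// -(ltr_nat R) (le_lt_trans _ (archi_boundP c0))//.
apply: powR_le_root => //.
have n0 : 0 < n.+1%:R :> R by [].
rewrite powRB ?gt_eqF// powRr1// ler_pdivrMr ?powR_gt0//.
by rewrite ler_pdivlMl.
Qed.

Section SignVectors.
Variables (R : realType) (I : choiceType) (p : R) (p1 : 1 <= p).
Implicit Types (s : seq I) (x : ell I p1).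

Lemma sign_vector_cons s x i (c : R) : i \notin s -> `|c| <= 1 ->
  (forall j, `|x j| <= (j \in s)%:R) ->
  forall j, `|(c *: ell_delta p1 i + x) j| <= (j \in i :: s)%:R.
Proof.
move=> is' c1 xs j; change (`|c * (j == i)%:R + x j| <= (j \in i :: s)%:R).
rewrite inE; have [->|ji] := eqVneq j i.
  have := xs i; rewrite (negbTE is') normr_le0 => /eqP->.
  by rewrite mulr1 addr0.
by rewrite mulr0 add0r; exact: xs.
Qed.

(** Take the sum of the unit vectors over s, each multiplied by the sign of f on it. *)
Lemma linear_form_sign_vector (f : ell I p1 -> R) (d : R) s :
  linear_for *%R f -> uniq s ->
  (forall i, i \in s -> d <= `|f (ell_delta p1 i)|) ->
  exists x, (forall j, `|x j| <= (j \in s)%:R) /\ d * (size s)%:R <= f x.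
Proof.
move=> fl; elim: s => [_ _|i s IH /= /andP[is' us] h].
  exists 0; split=> [j|]; first by rewrite normr0.
  have := fl (-1) 0 0; rewrite scaler0 addr0 => ->.
  by rewrite mulN1r addNr mulr0.
have [|x [xs fx]] := IH us; first by move=> j js; rewrite h// inE js orbT.
exists (Num.sg (f (ell_delta p1 i)) *: ell_delta p1 i + x); split.
  apply: sign_vector_cons => //; rewrite normr_sg.
  by case: (_ == 0).
rewrite fl -normrEsg -natr1 mulrDr mulr1 addrC lerD//.
by rewrite h// mem_head.
Qed.

End SignVectors.

Section BilinearCount.
Variables (R : realType) (I J : choiceType) (p q : R).
Variables (p1 : 1 <= p) (q1 : 1 <= q).

Definition contractive_bilinear (b : ell I p1 -> ell J q1 -> R) :=
  [/\ forall y, linear_for *%R (b^~ y), forall x, linear_for *%R (b x) &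
      forall x y, `|b x y| <= `|x| * `|y|].

(* The signs are chosen so that the off-diagonal terms never decrease b x y. *)
Lemma matching_sign_vectors b (d : R) (M : seq (I * J)) :
  contractive_bilinear b -> uniq (map fst M) -> uniq (map snd M) ->
  (forall z, z \in M -> d <= `|b (ell_delta p1 z.1) (ell_delta q1 z.2)|) ->
  exists (x : ell I p1) (y : ell J q1), [/\ forall i, `|x i| <= (i \in map fst M)%:R,
    forall j, `|y j| <= (j \in map snd M)%:R & d * (size M)%:R <= b x y].
Proof.
move=> [bl br _]; elim: M => [_ _ _|z M IH /= /andP[zM1 uM1] /andP[zM2 uM2] h].
  exists 0, 0; split=> [i|j|]; rewrite ?normr0//.
  have := bl 0 (-1) 0 0; rewrite scaler0 addr0 => ->.
  by rewrite mulN1r addNr mulr0.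
have [|x [y [xM yM bxy]]] := IH uM1 uM2.
  by move=> u uM; rewrite h// inE uM orbT.
set a := ell_delta p1 z.1; set c := ell_delta q1 z.2.
pose s := Num.sg (b a c).
(* With coefficients [t] and [t * s] the new diagonal term is [|b a c|] for either value of t, since
   [t * t = 1]; t is thus free to make the cross terms nonnegative. *)
pose t : R := if 0 <= b a y + s * b x c then 1 else -1.
have t1 : `|t| <= 1 by rewrite /t; case: ifP => _; rewrite ?normrN normr1.
have s1 : `|s| <= 1 by rewrite normr_sg; case: (_ == 0).
have ts1 : `|t * s| <= 1 by rewrite normrM mulr_ile1.
exists (t *: a + x), (t * s *: c + y); split.
- exact: sign_vector_cons.
- exact: sign_vector_cons.
have -> : b (t *: a + x) (t * s *: c + y) =
    t * t * `|b a c| + t * (b a y + s * b x c) + b x y.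
  by rewrite bl !br normrEsg -/s; ring.
have -> : t * t = 1 by rewrite /t; case: ifP => _; ring.
have tpos : 0 <= t * (b a y + s * b x c).
  by rewrite /t; case: (leP 0 (b a y + _)) => [|/ltW]; rewrite ?mul1r// mulN1r oppr_ge0.
have := h z (mem_head _ _); rewrite -/a -/c -natr1 => hz; nra.
Qed.

End BilinearCount.

(** Testing b on sign vectors turns n large entries of one shape into [d n <= n^r] with [r < 1]: r
    is [1/q] along a row, [1/p] along a column and [1/p + 1/q] on a matching. Bounded rows and
    columns then let [ex_matching] bound the whole set. *)
Lemma contractive_bilinear_count (R : realType) (I J : choiceType) (p q : R)
  (p1 : 1 <= p) (q1 : 1 <= q) (d : R) : p^-1 + q^-1 < 1 -> 0 < d ->
  exists N : nat, forall b : ell I p1 -> ell J q1 -> R, contractive_bilinear b ->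
  forall s : seq (I * J), uniq s ->
  (forall z, z \in s -> d <= `|b (ell_delta p1 z.1) (ell_delta q1 z.2)|) ->
  (size s <= N)%N.
Proof.
move=> pq d0.
have p0 : 0 < p^-1 by rewrite invr_gt0 (lt_le_trans _ p1).
have q0 : 0 < q^-1 by rewrite invr_gt0 (lt_le_trans _ q1).
have [N hN] := sublinear_growth_bound d0 pq.
have [Np hNp] := sublinear_growth_bound d0 (lt_trans (ltr_pwDr q0 (lexx _)) pq).
have [Nq hNq] := sublinear_growth_bound d0 (lt_trans (ltr_pwDl p0 (lexx _)) pq).
exists ((maxn Np Nq + maxn Np Nq) * N)%N => b [bl br bc] s us hs.
have [t|u|M [Ms M1 M2 sM]] := @ex_matching _ _ s (maxn Np Nq).
- pose D := map snd [seq z <- s | z.1 == t].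
  have -> : count (fun z => z.1 == t) s = size D by rewrite size_map size_filter.
  rewrite leq_max; apply/orP; right; apply: hNq.
  have uD : uniq D.
    rewrite map_inj_in_uniq ?filter_uniq// => -[i j] [i' j'].
    by rewrite !mem_filter /= => /andP[/eqP-> _] /andP[/eqP-> _] ->.
  have [j|y [yD hy]] := linear_form_sign_vector (br (ell_delta p1 t)) uD (d := d).
    move=> /mapP[z]; rewrite mem_filter => /andP[/eqP<- zs] ->; exact: hs.
  apply: le_trans hy (le_trans (ler_norm _) (le_trans (bc _ _) _)).
  rewrite -[leRHS]mul1r; apply: ler_pM => //; first exact: norm_ell_delta_le1.
  exact: ell_norm_le_size.
- pose D := map fst [seq z <- s | z.2 == u].
  have -> : count (fun z => z.2 == u) s = size D by rewrite size_map size_filter.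
  rewrite leq_max; apply/orP; left; apply: hNp.
  have uD : uniq D.
    rewrite map_inj_in_uniq ?filter_uniq// => -[i j] [i' j'].
    by rewrite !mem_filter /= => /andP[/eqP-> _] /andP[/eqP-> _] ->.
  have [j|x [xD hx]] := linear_form_sign_vector (bl (ell_delta q1 u)) uD (d := d).
    move=> /mapP[z]; rewrite mem_filter => /andP[/eqP<- zs] ->; exact: hs.
  apply: le_trans hx (le_trans (ler_norm _) (le_trans (bc _ _) _)).
  rewrite -[leRHS]mulr1; apply: ler_pM => //; last exact: norm_ell_delta_le1.
  exact: ell_norm_le_size.
apply: leq_trans sM _; rewrite leq_mul2l; apply/orP; right; apply: hN.
have [|x [y [xM yM hxy]]] := matching_sign_vectors (And3 bl br bc) M1 M2 (d := d).
  by move=> z /Ms; exact: hs.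
apply: le_trans hxy (le_trans (ler_norm _) (le_trans (bc _ _) _)).
rewrite powRD; last by rewrite gt_eqF ?implybT// addr_gt0.
apply: ler_pM => //.
  by rewrite -(size_map fst); exact: ell_norm_le_size.
by rewrite -(size_map snd); exact: ell_norm_le_size.
Qed.

Lemma closed_subspace_preimage (R : realType) (V W : normedModType R)
  (f : V -> W) (k : R) (A : set W) : linear f -> (forall x, `|f x| <= k * `|x|) ->
  closed_subspace A -> closed_subspace (f @^-1` A).
Proof.
move=> fl fk [A0 AD Ac]; split=> [|a x y Ax Ay|x hx] /=.
- have := fl (-1) 0 0; rewrite scaler0 addr0 scaleN1r addNr => ->; exact: A0.
- by rewrite fl; exact: AD.
- have k0 : 0 < `|k| + 1 by rewrite ltr_wpDl.
  apply: Ac => d d0; have [y Ay xy] := hx _ (divr_gt0 d0 k0).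
  exists (f y) => //.
  have -> : f x - f y = f (x - y) by rewrite addrC -scaleN1r -fl scaleN1r addrC.
  apply: le_trans (fk _) _.
  apply: (@le_trans _ _ ((`|k| + 1) * `|x - y|)).
    by rewrite ler_wpM2r// (le_trans (ler_norm k))// lerDl.
  by rewrite mulrC -ler_pdivlMr.
Qed.

(** * Elementary tensors *)

Section PureTensor.
Variables (R : realType) (X Y : normedModType R).

Fact pure_tensor_subproof (x : X) (y : Y) :
  rank_one_sum [:: (x, y)] \in @is_tensor R X Y.
Proof. by apply/asboolP; exists [:: (x, y)]. Qed.

Definition pure_tensor (x : X) (y : Y) : projective_tensor_product X Y :=
  completion_embed (projective_seminorm X Y) (Tensor (pure_tensor_subproof x y)).

Lemma pure_tensor_linearl y : linear (pure_tensor^~ y).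
Proof.
move=> a x x'; rewrite /pure_tensor -linearP; congr completion_embed.
apply/val_inj/funext => B.
change (rank_one_sum [:: (a *: x + x', y)] B =
  a * rank_one_sum [:: (x, y)] B + rank_one_sum [:: (x', y)] B).
by rewrite /rank_one_sum !big_seq1 linearDl linearZl_LR.
Qed.

Lemma pure_tensor_linearr x : linear (pure_tensor x).
Proof.
move=> a y y'; rewrite /pure_tensor -linearP; congr completion_embed.
apply/val_inj/funext => B.
change (rank_one_sum [:: (x, a *: y + y')] B =
  a * rank_one_sum [:: (x, y)] B + rank_one_sum [:: (x, y')] B).
by rewrite /rank_one_sum !big_seq1 linearDr linearZr.
Qed.

Lemma norm_pure_tensor x y : `|pure_tensor x y| <= `|x| * `|y|.
Proof.
rewrite norm_completion_embed; apply: (@le_trans _ _ (representation_cost [:: (x, y)])).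
  exact: projective_norm_le.
by rewrite /representation_cost big_seq1.
Qed.

(** Totality is used in one variable at a time, on preimages of A under the bounded maps
    [x |-> pure_tensor x (f j)] and [y |-> pure_tensor x y]. Finite sums of elementary tensors
    follow, and they are dense in the completion. *)
Lemma total_pure_tensor (I J : Type) (e : I -> X) (f : J -> Y) :
  total e -> total f -> total (fun z : I * J => pure_tensor (e z.1) (f z.2)).
Proof.
move=> te tf A cA Aef.
have Ae x j : A (pure_tensor x (f j)).
  have cl : closed_subspace ((pure_tensor^~ (f j)) @^-1` A).
    apply: (@closed_subspace_preimage _ _ _ _ `|f j|) cA => [|{}x].
      exact: pure_tensor_linearl.
    by rewrite mulrC norm_pure_tensor.
  by apply: te cl _ x => i; exact: (Aef (i, j)).
have At x y : A (pure_tensor x y).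
  have cl : closed_subspace (pure_tensor x @^-1` A).
    apply: (@closed_subspace_preimage _ _ _ _ `|x|) cA => [|{}y].
      exact: pure_tensor_linearr.
    exact: norm_pure_tensor.
  by apply: tf cl _ y => j; exact: Ae.
case: cA => A0 AD Ac.
have As r : forall u : tensor X Y, tensor_val u = rank_one_sum r ->
    A (completion_embed (projective_seminorm X Y) u).
  elim: r => [|[x y] r IH] u ur.
    rewrite (_ : u = 0) ?linear0//; apply/val_inj; rewrite /= ur.
    by apply/funext => B; rewrite /rank_one_sum big_nil.
  pose v := Tensor (pure_tensor_subproof x y).
  rewrite -(subrK v u) addrC -[v]scale1r linearP; apply: AD; first exact: At.
  apply: IH; apply/funext => B; rewrite scale1r.
  change (tensor_val u B - rank_one_sum [:: (x, y)] B = rank_one_sum r B).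
  by rewrite ur /rank_one_sum big_cons big_seq1 addrC addKr.
move=> x; apply: Ac => d d0.
have b0 : ball x d !=set0 by exists x; exact: ballxx.
have [z [xz [u _ uz]]] := completion_embed_dense b0 (@ball_open _ _ _ _).
exists (completion_embed (projective_seminorm X Y) u).
  by have /asboolP[r ur] := valP u; exact: As ur.
by rewrite uz ltW//; move: xz; rewrite -ball_normE.
Qed.

End PureTensor.

Theorem theorem6p2 (R : realType) (Gamma Delta : choiceType) (p q : R)
  (Gamma_neq0 : [set: Gamma] !=set0) (Delta_neq0 : [set: Delta] !=set0)
  (p1 : 1 < p) (q1 : 1 < q) (pq : p^-1 + q^-1 < 1) :
  subspace_of_hilbert_generated
    (projective_tensor_product (ell Gamma (ltW p1)) (ell Delta (ltW q1))).
Proof.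
pose e (z : Gamma * Delta) :=
  pure_tensor (ell_delta (ltW p1) z.1) (ell_delta (ltW q1) z.2).
apply: (@subspace_of_hilbert_generated_count _ _ _ e).
- move=> z; apply: le_trans (norm_pure_tensor _ _) _.
  by apply: mulr_ile1 => //; exact: norm_ell_delta_le1.
- by apply: total_pure_tensor; exact: total_ell_delta.
- move=> d d0.
  have [N hN] := @contractive_bilinear_count R Gamma Delta p q
    (ltW p1) (ltW q1) d pq d0.
  exists N => phi hphi s us hs.
  (* A functional in the dual ball of the projective tensor product restricts on elementary tensors
     to a contractive bilinear form, to which the count applies. *)
  apply: (hN (fun x y => phi (pure_tensor x y))) us hs; split=> [y a x x'|x a y y'|x y].
  + by rewrite pure_tensor_linearl linearP.
  + by rewrite pure_tensor_linearr linearP.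
  + exact: le_trans (hphi _) (norm_pure_tensor _ _).
Qed.
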